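(* Let $V\in \ell^1(H^{-1})$. Then for every $E>0$ there is an eigensolution at energy $E$ with the WKB asymptotic behavior.
   Context: Notation: $\mathbb{R}_+=(0,\infty)$; $\mathrm{AC}_{\mathrm{loc}}(\mathbb{R}_+)$ denotes functions on $[0,\infty)$ absolutely continuous on every $[0,R]$; $\mathcal D'(\mathbb{R}_+)$ denotes distributions on the half-line. For $1\le p,q<\infty$, $\ell^p(L^q)=\{f : \sum_{n=0}^\infty \|f\chi_{(n,n+1)}\|_{q}^p<\infty\}$ (functions on the half-line), and $\ell^p(H^{-1})=\{\sigma'+\tau : \sigma\in\ell^p(L^2),\ \tau\in\ell^p(L^1)\}\subset\mathcal D'(\mathbb{R}_+)$, where $\sigma'$ is the distributional derivative. Potentials are half-line distributions $V=\sigma'+\tau$ with $\sigma,\tau$ real-valued, $\sup_{x\ge0}\|\sigma\chi_{(x,x+1)}\|_2<\infty$ and $\sup_{x\ge 0}\|\tau\chi_{(x,x+1)}\|_1<\infty$. $V$ is called $H^{-1}$-decaying if its local $H^{-1}$ norms tend to $0$ at $+\infty$, equivalently if it has such a decomposition with $\|\sigma\chi_{(x,x+1)}\|_2+\|\tau\chi_{(x,x+1)}\|_1\to0$ as $x\to\infty$; for $H^{-1}$-decaying $V$ the decomposition $V=\sigma'+\tau$ is always chosen with this decay property. Every $V\in\ell^p(H^{-1})$, $1\le p<\infty$, is $H^{-1}$-decaying. The quasiderivative is $u^{[1]}=u'-\sigma u$. On $\mathfrak D=\{u\in\mathrm{AC}_{\mathrm{loc}}(\mathbb{R}_+): u^{[1]}\in\mathrm{AC}_{\mathrm{loc}}(\mathbb{R}_+)\}$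 define $\ell u=-(u^{[1]})'-\sigma u^{[1]}+(\tau-\sigma^2)u$. An eigensolution at energy $E$ is a (complex-valued) function $u\in\mathfrak D$ with $\ell u=Eu$ almost everywhere. An eigensolution $u$ at energy $E=k^2$, $k=\sqrt E>0$, has the WKB asymptotic behavior if, as $x\to+\infty$, $$u(x)=e^{ikx-\frac{i}{2k}\int_0^x\tau(t)\,dt}+o(1),\qquad u^{[1]}(x)=ik\,e^{ikx-\frac{i}{2k}\int_0^x\tau(t)\,dt}+o(1).$$ (For two decompositions $V=\sigma'+\tau$ with the decay property $\|\sigma\chi_{(x,x+1)}\|_2+\|\tau\chi_{(x,x+1)}\|_1\to0$ as $x\to\infty$, this notion differs only by multiplication of $u$ by a unimodular constant.) *)

(* Defs.v *)
From HB Require Import structures.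
From mathcomp Require Import all_boot all_order all_algebra.
From mathcomp Require Import all_classical all_reals all_analysis.
From mathcomp Require Import complex.

Set Implicit Arguments.
Unset Strict Implicit.
Unset Printing Implicit Defensive.

Import Order.TTheory GRing.Theory Num.Theory.
Import numFieldNormedType.Exports.

Local Open Scope ring_scope.
Local Open Scope complex_scope.
Local Open Scope classical_set_scope.

(* A function on the half-line is a total function on R of which only the
   values on [0, +oo[ matter. *)

Definition test_function (R : realType) (phi : R -> R) : Prop :=
  (forall (n : nat) (x : R), derivable (phi^`(n)) x 1) /\
  (exists a b : R, 0 < a /\ forall x : R, x \notin `[a, b] -> phi x = 0).

(* Potentials are real-valued, so real distributions suffice.  Only the values
   of [pairing] on test functions are meaningful. *)
Record half_line_distribution (R : realType) := HalfLineDistribution {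
  pairing :> (R -> R) -> R ;
  pairing_linear : forall (c : R) (phi psi : R -> R),
    test_function phi -> test_function psi ->
    pairing (fun x => c * phi x + psi x) = c * pairing phi + pairing psi ;
  pairing_continuous : forall a b : R, 0 < a ->
    exists (N : nat) (C : R), forall phi : R -> R,
      test_function phi -> (forall x : R, x \notin `[a, b] -> phi x = 0) ->
      forall M : R,
        (forall (k : nat) (x : R), (k <= N)%N -> `|(phi^`(k)) x| <= M) ->
        `|pairing phi| <= C * M }.

Definition regular_functional (R : realType) (f : R -> R) : (R -> R) -> R :=
  fun phi => \int[@lebesgue_measure R]_(x in `[0, +oo[) (f x * phi x).

Definition distributional_derivative (R : realType) (T : (R -> R) -> R) :
    (R -> R) -> R :=
  fun phi => - T (phi^`()).

Definition decomposes (R : realType) (V : half_line_distribution R)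
    (sigma tau : R -> R) : Prop :=
  forall phi : R -> R, test_function phi ->
    V phi = distributional_derivative (regular_functional sigma) phi
            + regular_functional tau phi.

(* f \chi_(x, x + 1) *)
Definition unit_cut (R : realType) (f : R -> R) (x : R) : R -> R :=
  fun y => f y * \1_(`]x, x + 1[ : set R) y.

Definition unit_norm (R : realType) (q : R) (f : R -> R) (x : R) : \bar R :=
  'N[@lebesgue_measure R]_(q%:E)[EFin \o unit_cut f x]%E.

Definition lpLq (R : realType) (p q : R) (f : R -> R) : Prop :=
  measurable_fun (`[0, +oo[ : set R) f /\
  (\sum_(0 <= n <oo) (unit_norm q f n%:R `^ p) < +oo)%E.

Definition lpHm1 (R : realType) (p : R) (V : half_line_distribution R) : Prop :=
  exists sigma tau : R -> R,
    lpLq p 2 sigma /\ lpLq p 1 tau /\ decomposes V sigma tau.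

Definition uniformly_locally_Lq (R : realType) (q : R) (f : R -> R) : Prop :=
  measurable_fun (`[0, +oo[ : set R) f /\
  (ereal_sup [set unit_norm q f x | x in (`[0%R, +oo[ : set R)] < +oo)%E.

Definition decaying_decomposition (R : realType) (V : half_line_distribution R)
    (sigma tau : R -> R) : Prop :=
  [/\ uniformly_locally_Lq 2 sigma,
      uniformly_locally_Lq 1 tau,
      decomposes V sigma tau &
      (unit_norm 2 sigma x + unit_norm 1 tau x)%E @[x --> +oo] --> 0%E].

Definition absolutely_continuous_on (R : realType) (a b : R) (u : R -> R[i])
    : Prop :=
  forall e : R, 0 < e -> exists2 d : R, 0 < d &
    forall (n : nat) (s t : 'I_n -> R),
      (forall j, a <= s j /\ s j <= t j /\ t j <= b) ->
      trivIset setT (fun j => `]s j, t j[%classic) ->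
      \sum_(j < n) (t j - s j) < d ->
      \sum_(j < n) ComplexField.Normc.normc (u (t j) - u (s j)) < e.

Definition ACloc (R : realType) (u : R -> R[i]) : Prop :=
  forall r : R, 0 < r -> absolutely_continuous_on 0 r u.

(* The derivative of a complex-valued function of a real variable, used only
   almost everywhere and on locally absolutely continuous functions. *)
Definition cderive1 (R : realType) (u : R -> R[i]) (x : R) : R[i] :=
  ((fun y => complex.Re (u y))^`() x) +i* ((fun y => complex.Im (u y))^`() x).

(* u^[1] = u' - sigma u is an a.e. defined function; u is in the domain when it
   has a locally absolutely continuous representative.  That representative is
   unique on [0, +oo[ and is passed along as [u1]. *)
Definition in_domain (R : realType) (sigma : R -> R) (u u1 : R -> R[i])
    : Prop :=
  [/\ ACloc u, ACloc u1 &
      {ae @lebesgue_measure R, forall x : R, 0 < x ->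
        u1 x = cderive1 u x - (sigma x)%:C * u x}].

Definition ell (R : realType) (sigma tau : R -> R) (u u1 : R -> R[i]) (x : R)
    : R[i] :=
  - cderive1 u1 x - (sigma x)%:C * u1 x
  + (tau x - sigma x ^+ 2)%:C * u x.

Definition eigensolution (R : realType) (sigma tau : R -> R) (E : R)
    (u u1 : R -> R[i]) : Prop :=
  in_domain sigma u u1 /\
  {ae @lebesgue_measure R, forall x : R, 0 < x ->
    ell sigma tau u u1 x = E%:C * u x}.

(* e^(i t) for real t *)
Definition expi (R : realType) (t : R) : R[i] := cos t +i* sin t.

Definition wkb_phase (R : realType) (tau : R -> R) (k x : R) : R :=
  k * x - (2 * k)^-1 * \int[@lebesgue_measure R]_(t in `[0, x]) tau t.

Definition WKB (R : realType) (tau : R -> R) (k : R) (u u1 : R -> R[i])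
    : Prop :=
  ComplexField.Normc.normc (u x - expi (wkb_phase tau k x))
    @[x --> +oo] --> (0 : R) /\
  ComplexField.Normc.normc (u1 x - 'i%C * k%:C * expi (wkb_phase tau k x))
    @[x --> +oo] --> (0 : R).

(* Main.v *)
Require Import Defs.
From mathcomp Require Import all_boot all_order all_algebra.
From mathcomp Require Import all_classical all_reals all_analysis.
From mathcomp Require Import measurable_realfun complex.
From mathcomp Require Import ring lra.
Set Implicit Arguments.
Unset Strict Implicit.
Unset Printing Implicit Defensive.

Import Order.TTheory GRing.Theory Num.Theory.
Import numFieldNormedType.Exports.
Local Open Scope ring_scope.
Local Open Scope complex_scope.
Local Open Scope classical_set_scope.

(* Both decompositions of V have the same distribution, so by du Bois-Reymond
   W := sigma - sigma0 agrees a.e. with the locally absolutely continuous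
   function c + int_0^x (tau0 - tau), where (sigma0, tau0) is the l^1 one; the
   decay of both decompositions forces W -> 0 at infinity.  Replacing y^[1] by
   y^[1] - W y turns eigensolutions for (sigma0, tau0) into eigensolutions for
   (sigma, tau), and the phases of the two decompositions differ by a convergent
   quantity, which a unimodular constant absorbs.

   For (sigma0, tau0): since l^1(L^2) is contained in both L^1 and L^2, the
   functions sigma0, sigma0^2 and tau0 are integrable.  Variation of constants
   turns the eigenvalue equation into z' = A z with A integrable, and the
   Volterra equation z(x) = z(oo) - int_x^oo A z is solved by Picard iteration
   for any prescribed limit z(oo). *)

(** * Primitives and absolute continuity *)

(** The l^1 assumption concerns some decomposition, whereas the asymptotics must hold for whichever
    decaying pair is given; there [tau] need not be integrable, so the Volterra argument does not
    apply to it directly. What saves the phase is that the primitive of [tau] equals that of [tau0]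
    minus W - c, hence still converges because W -> 0: the given phase is k x + theta + o(1) for a
    constant theta. The unimodular factor e^(i theta) is therefore put into the data at infinity
    from the start instead of being multiplied in at the end. All coefficients are real, so Re u and
    Im u are obtained separately, from the same real system with different data at infinity. The
    total mass of A may be large, so the Volterra operator need not contract in the sup norm except
    near +oo. A bounded weight makes it a contraction on the whole line at once and avoids
    continuing a solution leftwards. Functions on the half-line are extended by 0 to R, and
    primitives then start at -oo. *)

Local Notation normc := ComplexField.Normc.normc.

Lemma Rintegral_dominated_cvg (d : measure_display) (T : measurableType d)
    (R : realType) (mu : {measure set T -> \bar R}) (D : set T)
    (f_ : nat -> T -> R) (f h : T -> R) :
  measurable D -> (forall n, measurable_fun D (f_ n)) ->
  (forall x, D x -> f_ n x @[n --> \oo] --> f x) ->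
  mu.-integrable D (EFin \o h) ->
  (forall n x, D x -> `|f_ n x| <= h x) ->
  mu.-integrable D (EFin \o f) /\
  \int[mu]_(x in D) f_ n x @[n --> \oo] --> \int[mu]_(x in D) f x.
Proof.
move=> mD mf_ f_f ih f_h.
have mf : measurable_fun D f by apply: measurable_fun_cvg f_f.
have [] := @dominated_convergence _ _ _ mu D mD (fun n => EFin \o f_ n)
  (EFin \o f) (EFin \o h).
- by move=> n; exact/measurable_EFinP.
- exact/measurable_EFinP.
- by apply/nearW => x Dx; apply: cvg_EFin; [exact: nearW|exact: f_f].
- by [].
- by apply/nearW => x n Dx; rewrite lee_fin f_h.
move=> fi _; rewrite -(fineK (integrable_fin_num mD fi)) => /fine_cvgP[_].
by split.
Qed.

(** No condition is imposed at +oo: this is what a function locally integrable on the closed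
    half-line satisfies once extended by 0, in particular the [tau] of a merely decaying
    decomposition. *)
Definition left_integrable (R : realType) (g : R -> R) : Prop :=
  forall y : R, (@lebesgue_measure R).-integrable `]-oo, y] (EFin \o g).

Definition primitive (R : realType) (g : R -> R) (x : R) : R :=
  \int[@lebesgue_measure R]_(t in `]-oo, x]) g t.

Section Primitive.
Context {R : realType}.
Local Notation mu := (@lebesgue_measure R).
Implicit Types (g : R -> R).

Lemma integrable_left_integrable g :
  mu.-integrable setT (EFin \o g) -> left_integrable g.
Proof. by move=> ig y; apply: integrableS ig. Qed.

Lemma left_integrable_itv g x y : left_integrable g ->
  mu.-integrable `]x, y] (EFin \o g).
Proof.
by move=> ig; apply: integrableS (ig y) => //; apply: subset_itvr; rewrite bnd_simp.
Qed.

Lemma primitiveB g x y : left_integrable g -> x <= y ->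
  primitive g y - primitive g x = \int[mu]_(t in `]x, y]) g t.
Proof.
by move=> ig xy; rewrite /primitive Rintegral_itvB ?bnd_simp//; exact: ig.
Qed.

Lemma left_integrable_locally g : left_integrable g ->
  locally_integrable setT g.
Proof.
move=> ig; split.
- have -> : [set: R] = \bigcup_(n : nat) `]-oo, n%:R]%classic.
    apply/seteqP; split => // x _; exists (Num.trunc `|x|).+1 => //=.
    rewrite in_itv/= (le_trans (ler_norm _))// ltW//.
    by have /andP[] := trunc_itv (normr_ge0 x).
  apply/measurable_fun_bigcup => // n.
  by have /integrableP[/measurable_EFinP] := ig n%:R.
- exact: openT.
- move=> K _ cK.
  have /compact_bounded [M [Mr MK]] := cK.
  have /integrableP[mg fg] := ig (M + 1).
  apply: le_lt_trans fg; apply: ge0_subset_integral => //.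
  + exact: compact_measurable.
  + by apply/measurable_EFinP; apply: measurableT_comp => //; exact/measurable_EFinP.
  + move=> x Kx /=; rewrite in_itv/= (le_trans (ler_norm _))//.
    by apply: MK => //; rewrite ltrDl.
Qed.

Lemma ae_is_derive_primitive g : left_integrable g ->
  {ae mu, forall x : R, is_derive x 1 (primitive g) (g x)}.
Proof.
move=> ig; have := FTC1Ny ig (left_integrable_locally ig).
apply: filterS; first exact: (ae_filter_ringOfSetsType mu).
move=> x [dp ep]; apply: (DeriveDef dp).
by rewrite -derive1E; exact: ep.
Qed.

(** Testing the limit along sequences turns it into dominated convergence for the truncations of
    [g]. *)
Lemma cvg_primitive g : mu.-integrable setT (EFin \o g) ->
  primitive g x @[x --> +oo] --> \int[mu]_t g t.
Proof.
move=> ig; apply/cvg_pinftyP => u uy.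
have [] := @Rintegral_dominated_cvg _ _ _ mu setT
  (fun n => g \_ `]-oo, u n]) g (Num.norm \o g) measurableT.
- move=> n; apply/(measurable_restrictT _ _).1 => //.
  by have /measurable_int/measurable_EFinP := integrable_left_integrable ig (u n).
- move=> x _; apply: cvg_near_cst; move/cvgryPge : uy => /(_ x).
  by apply: filterS => n xu; rewrite patchE mem_set//= in_itv.
- exact: integrable_norm.
- by move=> n x _; rewrite patchE; case: ifPn => //= _; rewrite normr0.
by move=> _; under eq_cvg do rewrite -Rintegral_mkcond.
Qed.

End Primitive.

Section Normc.
Context {R : realType}.
Implicit Types (z : R[i]) (x : R).

Lemma normc_real x : normc x%:C = `|x|.
Proof. by rewrite /normc/= expr0n/= addr0 sqrtr_sqr. Qed.

Lemma normc_ge0 z : 0 <= normc z.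
Proof. by case: z => a b; exact: sqrtr_ge0. Qed.

Lemma normc_i : normc ('i : R[i]) = 1.
Proof. by rewrite /normc/= expr0n/= add0r expr1n sqrtr1. Qed.

End Normc.

Section AbsolutelyContinuous.
Context {R : realType}.
Implicit Types (a b : R) (u v : R -> R[i]).

Lemma absolutely_continuous_on_cst a b (z : R[i]) :
  absolutely_continuous_on a b (fun=> z).
Proof.
move=> e e0; exists 1 => // n s t _ _ _; rewrite big1// => j _.
by rewrite subrr ComplexField.Normc.normc0.
Qed.

Lemma absolutely_continuous_onD a b u v :
  absolutely_continuous_on a b u -> absolutely_continuous_on a b v ->
  absolutely_continuous_on a b (fun x => u x + v x).
Proof.
move=> acu acv e e0; have e20 : 0 < e / 2 by rewrite divr_gt0.
have [d d0 du] := acu _ e20; have [d' d'0 dv] := acv _ e20.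
exists (Num.min d d'); first by rewrite lt_min d0.
move=> n s t st tr; rewrite lt_min => /andP[std std'].
rewrite (le_lt_trans (y := \sum_(j < n) (normc (u (t j) - u (s j)) +
  normc (v (t j) - v (s j)))))//.
  apply: ler_sum => j _; apply: le_trans (le_normcD _ _).
  by rewrite opprD addrACA.
by rewrite big_split/= [e]splitr ltrD// ?du ?dv.
Qed.

Lemma absolutely_continuous_onM a b u v (M N : R) :
  absolutely_continuous_on a b u -> absolutely_continuous_on a b v ->
  (forall x, a <= x <= b -> normc (u x) <= M) ->
  (forall x, a <= x <= b -> normc (v x) <= N) ->
  absolutely_continuous_on a b (fun x => u x * v x).
Proof.
move=> acu acv uM vN e e0.
(* [K] dominates both bounds and is positive whatever the signs of [M] and [N], which are
   unconstrained when the interval is empty. *)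
pose K := `|M| + `|N| + 1.
have K0 : 0 < K by rewrite ltr_wpDl// addr_ge0.
have e20 : 0 < e / 2 / K by rewrite !divr_gt0.
have [d d0 du] := acu _ e20; have [d' d'0 dv] := acv _ e20.
exists (Num.min d d'); first by rewrite lt_min d0.
move=> n s t st tr; rewrite lt_min => /andP[std std'].
rewrite (le_lt_trans (y := \sum_(j < n) (K * normc (u (t j) - u (s j)) +
  K * normc (v (t j) - v (s j)))))//.
  apply: ler_sum => j _.
  have [asj [sj tj]] := st j.
  rewrite (_ : _ - _ = (u (t j) - u (s j)) * v (t j) +
    u (s j) * (v (t j) - v (s j))); last by ring.
  apply: le_trans (le_normcD _ _) _; rewrite !ComplexField.Normc.normcM.
  rewrite lerD//.
    rewrite mulrC ler_wpM2r ?normc_ge0//.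
    apply: (le_trans (vN _ _)); first by rewrite tj (le_trans asj).
    by rewrite /K (le_trans (ler_norm _))// addrAC lerDr addr_ge0.
  rewrite ler_wpM2r ?normc_ge0//.
  apply: (le_trans (uM _ _)); first by rewrite asj (le_trans sj).
  by rewrite /K (le_trans (ler_norm _))// -addrA lerDl addr_ge0.
rewrite big_split/= -!mulr_sumr [e]splitr ltrD//.
  by rewrite mulrC -ltr_pdivlMr// du.
by rewrite mulrC -ltr_pdivlMr// dv.
Qed.

Lemma absolutely_continuous_on_lipschitz a b u (k : R) :
  (forall x y, x <= y -> normc (u y - u x) <= k * (y - x)) ->
  absolutely_continuous_on a b u.
Proof.
move=> lu e e0; have k1 : 0 < `|k| + 1 by rewrite ltr_wpDl.
exists (e / (`|k| + 1)); first by rewrite divr_gt0.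
move=> n s t st _; rewrite ltr_pdivlMr// mulr_suml; apply: le_lt_trans.
apply: ler_sum => j _; have [_ [sj _]] := st j.
rewrite (le_trans (lu _ _ sj))// mulrC ler_wpM2l ?subr_ge0//.
by rewrite (le_trans (ler_norm _))// lerDl.
Qed.

(** This is absolute continuity of the integral: the disjoint intervals form a set of small measure,
    over which the integral of |g| is small and bounds the sum of the increments. *)
Lemma absolutely_continuous_on_primitive a b (g : R -> R) :
  left_integrable g ->
  absolutely_continuous_on a b (fun x => (primitive g x)%:C).
Proof.
move=> ig e e0.
(* Truncation at [b] gives global integrability and leaves the increments inside [a, b]
   unchanged. *)
pose gb := g \_ `]-oo, b].
have igb : lebesgue_measure.-integrable setT (EFin \o gb).
  have /integrable_mkcond := ig b; rewrite restrict_EFin; apply; exact: measurable_itv.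
have [d [d0 dP]] := integral_normr_continuous igb e0.
exists d => // n s t st tr sd.
pose F (j : 'I_n) := `]s j, t j[%classic : set R.
have mF j : measurable (F j) by exact: measurable_itv.
pose D := \big[setU/set0]_(j < n) F j.
have mD : measurable D by exact: bigsetU_measurable.
have muD : (lebesgue_measure D < d%:E)%E.
  rewrite measure_bigsetU_ord//.
  rewrite (eq_bigr (fun j => (t j - s j)%:E)); first by rewrite sumEFin lte_fin.
  move=> j _; have [_ [sj _]] := st j.
  rewrite [LHS](lebesgue_measure_itv `]s j, t j[%R)/= lte_fin; case: ltP => //.
  by move=> tj; rewrite (_ : t j = s j) ?subrr//; apply/le_anti/andP.
have := dP _ mD muD; apply: le_lt_trans.
have ing := integrable_norm igb.
rewrite -lee_fin /Rintegral fineK; last first.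
  by apply: integrable_fin_num => //; exact: integrableS ing.
rewrite integral_bigsetU_EFin//; last 3 first.
- exact: index_enum_uniq.
- by apply: sub_trivIset tr.
- case/integrableP : ing => ing _; exact: measurable_funS ing.
rewrite -sumEFin; apply: lee_sum => j _; have [_ [sj tj]] := st j.
rewrite -rmorphB normc_real primitiveB//.
rewrite EFin_normr_Rintegral//; last exact: left_integrable_itv.
rewrite integral_itv_bndoo//=; last first.
  apply: measurable_funS (measurable_int _ (left_integrable_itv (s j) (t j) ig)) => //.
  by apply: subset_itvl; rewrite bnd_simp.
apply: (le_trans (le_abse_integral _ _ _)) => //.
  apply: measurable_funS (measurable_int _ (left_integrable_itv (s j) (t j) ig)) => //.
  by apply: subset_itvl; rewrite bnd_simp.
rewrite le_eqVlt; apply/orP; left; apply/eqP; apply: eq_integral => x.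
rewrite inE /F/= in_itv/= => /andP[_ xt]; rewrite /gb patchE mem_set//=.
by rewrite in_itv/= (le_trans (ltW xt)).
Qed.

(** Absolute continuity on [x - 1, x + 1], tested on a single interval with endpoint x. *)
Lemma continuous_primitive (g : R -> R) :
  left_integrable g -> continuous (primitive g).
Proof.
move=> ig x; apply/cvgrPdist_lt => e e0.
have [d d0 dP] := absolutely_continuous_on_primitive (x - 1) (x + 1) ig e0.
have P s t : x - 1 <= s -> s <= t -> t <= x + 1 -> t - s < d ->
    `|primitive g t - primitive g s| < e.
  move=> xs st tx std.
  have := dP 1%N (fun=> s) (fun=> t).
  rewrite !big_ord1 -rmorphB normc_real; apply => // i j _ _ _.
  by rewrite (ord1 i) (ord1 j).
near=> y.
have xy1 : `|x - y| < 1 by near: y; exact: (@nbhsx_ballx _ _ x 1).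
have xyd : `|x - y| < d by near: y; exact: (nbhsx_ballx x d d0).
have [xy|yx] := leP x y.
  by rewrite distrC; apply: P => //; move: xy1 xyd; rewrite !ltr_norml; lra.
by apply: P; rewrite ?(ltW yx)//; move: xy1 xyd; rewrite !ltr_norml; lra.
Unshelve. all: by end_near. Qed.

End AbsolutelyContinuous.

(** * A linear Volterra equation on the line *)

Section VolterraWeight.
Context {R : realType}.
Local Notation mu := (@lebesgue_measure R).

(** Tail integration divides an exponential of rate k by k. A kernel bounded by k / 4 therefore
    costs exactly a quarter of an exponential weight of rate k. *)
Lemma integral_expR_tail (k a y : R) : 0 < k ->
  (\int[mu]_(t in `[y, +oo[) (k * expR (k * (a - t)))%:E =
   (expR (k * (a - y)))%:E)%E.
Proof.
move=> k0.
have dE (x : R) : is_derive x 1 (fun t => - expR (k * (a - t))) (k * expR (k * (a - x))).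
  by apply: is_derive_eq; rewrite /GRing.scale/=; ring.
have cE : continuous (fun t : R => expR (k * (a - t))).
  move=> x; apply: (@continuous_comp _ _ _ (fun t : R => k * (a - t)) expR).
    apply: continuousM; first exact: cst_continuous.
    by apply: continuousB; [exact: cst_continuous|exact: cvg_id].
  exact: continuous_expR.
rewrite (@ge0_continuous_FTC2y _ _ (fun t => - expR (k * (a - t))) _ 0).
- by rewrite EFinN oppeK add0e.
- by move=> x _; rewrite mulr_ge0 ?expR_ge0// ltW.
- apply: continuous_subspaceT => x; apply: cvgMr; exact: cE.
- rewrite -[X in _ --> X]oppr0; apply: cvgN.
  rewrite (_ : (fun x => _) =
    (fun x => expR (k * a) * ((fun z => expR (- z)) \o (fun z => k * z)) x)); last first.
    by apply/funext => x /=; rewrite -expRD; congr expR; ring.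
  rewrite -[X in _ --> X](mulr0 (expR (k * a))); apply: cvgMr.
  apply: (@cvg_comp _ _ _ _ _ _ (pinfty_nbhs R)); last exact: cvgr_expR.
  exact: gt0_cvgMry.
- by move=> x _; exact: ex_derive.
- by apply: cvg_at_right_filter; apply: cvgN; exact: cE.
- by move=> x _; rewrite derive1E; exact: derive_val.
Qed.

(* In the norm sup |f| / w the Volterra operator with kernel m has norm at most
   1/2.  The function m is the sum of a function supported in [-L, L] and bounded
   by L, and of a remainder r of integral less than 1/4; an exponential weight
   of rate 4L damps the former, monotonicity of w handles the latter. *)
Lemma Volterra_weight (m : R -> R) : (forall t, 0 <= m t) ->
  mu.-integrable setT (EFin \o m) ->
  exists (w : R -> R) (b : R),
    [/\ measurable_fun setT w, forall x, 1 <= w x <= b &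
      forall x, \int[mu]_(t in `]x, +oo[) (m t * w t) <= w x / 2].
Proof.
move=> m0 im.
have mm : measurable_fun setT m by have /measurable_int/measurable_EFinP := im.
pose G (n : nat) : set R := [set t | m t <= n%:R] `&` `[- n%:R, n%:R].
have mG n : measurable (G n).
  apply: measurableI => //; rewrite -[X in measurable X]setTI.
  by apply: measurable_fun_le => //.
pose r (n : nat) : R -> R := m \_ (~` G n).
have r0 n t : 0 <= r n t by rewrite /r patchE; case: ifPn.
have rm n t : r n t <= m t by rewrite /r patchE; case: ifPn.
have mr n : measurable_fun setT (r n).
  apply/(measurable_restrictT _ _).1; first exact: measurableC.
  exact: measurable_funS mm.
have ir n : mu.-integrable setT (EFin \o r n).
  apply: le_integrable im => //; first by apply/measurable_EFinP; exact: mr.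
  by move=> t _ /=; rewrite lee_fin !ger0_norm.
(* The remainders tend to 0 pointwise and are dominated by [m]. The index is a successor so that the
   cut-off level [L] is positive. *)
have [n rn4] : exists n : nat, \int[mu]_t r n.+1 t < 4^-1.
  have [] := @Rintegral_dominated_cvg _ _ _ mu setT r (cst 0) m measurableT.
  - exact: mr.
  - move=> t _; apply: cvg_near_cst; near=> n.
    rewrite /r patchE memNset//= /G/= => -[]//.
    split; first by near: n; exact: nbhs_infty_ger.
    by rewrite in_itv/= -ler_norml; near: n; exact: nbhs_infty_ger.
  - exact: im.
  - by move=> n t _; rewrite ger0_norm.
  rewrite Rintegral_cst// mul0r => _ /cvgrPdist_lt /(_ 4^-1).
  rewrite invr_gt0 ltr0n => /(_ isT) [n _ /(_ n.+1)] /=.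
  rewrite sub0r normrN ger0_norm; last by apply: Rintegral_ge0.
  by move=> H; exists n; exact: H.
pose L : R := n.+1%:R.
have L0 : 0 < L by rewrite ltr0n.
pose k := 4 * L; have k0 : 0 < k by rewrite mulr_gt0.
(* Clamping x to [-L, L] keeps the weight between 1 and e^(2 k L), so that weighted and unweighted
   bounds are equivalent. *)
pose w (x : R) := expR (k * (L - Num.min (Num.max x (- L)) L)).
have mw : measurable_fun setT w.
  apply: measurableT_comp => //; apply: measurable_funM => //.
  apply: measurable_funB => //; apply: measurable_minr => //.
  exact: measurable_maxr.
have w0 x : 0 <= w x by exact: expR_ge0.
have w1 x : 1 <= w x <= expR (k * (2 * L)).
  have yL : Num.min (Num.max x (- L)) L <= L by rewrite ge_min lexx orbT.
  have Ly : - L <= Num.min (Num.max x (- L)) L.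
    by rewrite le_min le_max lexx orbT; lra.
  by rewrite /w -{1}expR0 !ler_expR ler_pM2l// pmulr_rge0//; apply/andP; split; lra.
have w_ninc x t : x <= t -> w t <= w x.
  move=> xt; rewrite ler_expR ler_pM2l// lerB//.
  have H : Num.max x (- L) <= Num.max t (- L) by rewrite ge_max !le_max xt lexx orbT.
  by rewrite le_min !ge_min H lexx orbT.
exists w, (expR (k * (2 * L))); split => // x.
have iwm : mu.-integrable setT (EFin \o (fun t => m t * w t)).
  apply: (le_integrable measurableT _ _
    (integrableZl measurableT (expR (k * (2 * L))) im)).
  - by apply/measurable_EFinP; exact: measurable_funM.
  - move=> t _ /=; rewrite lee_fin !ger0_norm ?mulr_ge0 ?expR_ge0//.
    by rewrite mulrC ler_wpM2r//; have /andP[] := w1 t.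
(* The bounded part of [m] meets ]x, +oo[ only at points t >= y, where m t <= L = k / 4 and w t =
   e^(k (L - t)); this product is at most [h t]. The tail integral of [h] from [y] is e^(k (L - y))
   / 4 <= w x / 4. *)
pose y := Num.max x (- L).
pose h t := 4^-1 * (k * expR (k * (L - t))).
have h0 t : 0 <= h t by rewrite !mulr_ge0 ?expR_ge0// ltW.
have wxy : expR (k * (L - y)) <= w x.
  by rewrite ler_expR ler_pM2l// lerB// ge_min lexx.
have mh : measurable_fun setT h.
  apply: measurable_funM => //; apply: measurable_funM => //.
  apply: measurableT_comp => //; apply: measurable_funM => //.
  exact: measurable_funB.
rewrite -lee_fin /Rintegral fineK; last first.
  by apply: integrable_fin_num => //; exact: integrableS iwm.
apply: (@le_trans _ _ (\int[mu]_(t in `]x, +oo[)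
  ((w x * r n.+1 t)%:E + ((h \_ `[y, +oo[) t)%:E))%E).
  apply: ge0_le_integral => //=.
  - by move=> t _; rewrite lee_fin mulr_ge0.
  - exact: measurable_funS (measurable_int _ iwm).
  - apply: emeasurable_funD; apply/measurable_EFinP.
      by apply: measurable_funM => //; apply: measurable_funS (mr _).
    apply: (@measurable_funS _ _ _ _ setT) => //.
    by apply/(measurable_restrictT _ _).1 => //; exact: measurable_funS mh.
  move=> t; rewrite in_itv/= andbT => xt; rewrite -EFinD lee_fin.
  rewrite /r [m \_ _ _]patchE; case: ifPn.
    move=> _; rewrite -[leLHS]addr0 lerD//.
      by rewrite mulrC ler_wpM2r// w_ninc// ltW.
    by rewrite patchE; case: ifPn.
  rewrite notin_setE/= => /contrapT[]/= mtL; rewrite in_itv/= => /andP[Lt tL].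
  rewrite mulr0 add0r patchE mem_set; last first.
    by rewrite /= in_itv/= andbT /y ge_max (ltW xt).
  rewrite /h /w (max_idPl Lt) (min_idPl tL) /k mulrA mulrA mulVf// mul1r.
  by rewrite ler_wpM2r// expR_ge0.
rewrite ge0_integralD//=; last 4 first.
- by move=> t _; rewrite lee_fin mulr_ge0.
- by apply/measurable_EFinP; apply: measurable_funM => //; apply: measurable_funS (mr _).
- by move=> t _; rewrite lee_fin patchE; case: ifPn.
- apply/measurable_EFinP; apply: (@measurable_funS _ _ _ _ setT) => //.
  by apply/(measurable_restrictT _ _).1 => //; exact: measurable_funS mh.
rewrite [w x / 2](_ : _ = w x / 4 + w x / 4); last by field.
rewrite EFinD leeD//.
  apply: (@le_trans _ _ (\int[mu]_t ((w x)%:E * (r n.+1 t)%:E))%E).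
    apply: ge0_subset_integral => //=.
    + by apply/measurable_EFinP; apply: measurable_funM => //; exact: mr.
    + by move=> t _; rewrite lee_fin mulr_ge0.
  rewrite (integralZl measurableT (ir _)) -(fineK (integrable_fin_num measurableT (ir _))).
  by rewrite -EFinM lee_fin ler_wpM2l// ltW.
apply: (@le_trans _ _ (\int[mu]_t ((h \_ `[y, +oo[) t)%:E)%E).
  apply: ge0_subset_integral => //=.
  - apply/measurable_EFinP.
    by apply/(measurable_restrictT _ _).1 => //; exact: measurable_funS mh.
  - by move=> t _; rewrite lee_fin patchE; case: ifPn.
rewrite (_ : (fun t => _) = ((EFin \o h) \_ `[y, +oo[)); last by rewrite restrict_EFin.
rewrite -integral_mkcond /h; under eq_integral do rewrite /= EFinM.
rewrite ge0_integralZl_EFin//; last 2 first.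
- by move=> t _; rewrite lee_fin mulr_ge0 ?expR_ge0// ltW.
- apply/measurable_EFinP; apply: (@measurable_funS _ _ _ _ setT) => //.
  apply: measurable_funM => //.
  apply: measurableT_comp => //; apply: measurable_funM => //.
  exact: measurable_funB.
by rewrite integral_expR_tail// -EFinM lee_fin mulrC ler_wpM2r.
Unshelve. all: by end_near. Qed.

End VolterraWeight.

Section Volterra.
Context {R : realType} {I : finType}.
Local Notation mu := (@lebesgue_measure R).
Variables (C : I -> I -> R -> R) (c : I -> R).
Hypothesis iC : forall i j, mu.-integrable setT (EFin \o C i j).

Let m (t : R) : R := \sum_i \sum_j `|C i j t|.

Let m_ge0 t : 0 <= m t.
Proof. by apply: sumr_ge0 => i _; apply: sumr_ge0. Qed.

Let row_le_m i t : \sum_j `|C i j t| <= m t.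
Proof.
rewrite /m [leRHS](bigD1 i)//= lerDl.
by apply: sumr_ge0 => k _; apply: sumr_ge0.
Qed.

Let im : mu.-integrable setT (EFin \o m).
Proof.
rewrite (_ : EFin \o m = fun t => (\sum_i \sum_j (EFin \o (Num.norm \o C i j)) t)%E).
  apply: (integrable_sum measurableT) => i _.
  by apply: (integrable_sum measurableT) => j _; exact: integrable_norm.
by apply/funext => t /=; rewrite -sumEFin; apply: eq_bigr => i _; rewrite -sumEFin.
Qed.

Let bounded_measurable (Z : I -> R -> R) :=
  (forall j, measurable_fun setT (Z j)) /\
  exists B : R, forall j t, `|Z j t| <= B.

Let g (Z : I -> R -> R) i t := \sum_j C i j t * Z j t.

Let mC i j : measurable_fun setT (C i j).
Proof. by have /measurable_int/measurable_EFinP := iC i j. Qed.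

Let mg Z i : bounded_measurable Z -> measurable_fun setT (g Z i).
Proof.
move=> [mZ _]; apply: measurable_sum => j; apply: measurable_funM => //.
Qed.

Let g_le Z i t (B : R) : (forall j, `|Z j t| <= B) -> `|g Z i t| <= m t * B.
Proof.
move=> ZB; have [j _|I0] := pickP (fun _ : I => true); last first.
  by have := I0 i.
have B0 : 0 <= B by apply: le_trans (ZB j).
apply: le_trans (ler_norm_sum _ _ _) _.
apply: (@le_trans _ _ (\sum_j `|C i j t| * B)).
  by apply: ler_sum => k _; rewrite normrM ler_wpM2l.
by rewrite -mulr_suml ler_wpM2r.
Qed.

Let ig Z i : bounded_measurable Z -> mu.-integrable setT (EFin \o g Z i).
Proof.
move=> bmZ; have [_ [B ZB]] := bmZ.
apply: (le_integrable measurableT _ _ (integrableZr measurableT B im)).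
  by apply/measurable_EFinP; exact: mg.
move=> t _ /=; rewrite lee_fin (le_trans (g_le i (ZB^~ t)))//.
exact: ler_norm.
Qed.

Let S (Z : I -> R -> R) i x := c i - \int[mu]_(t in `]x, +oo[) g Z i t.

Let SE Z i x : bounded_measurable Z ->
  S Z i x = c i - \int[mu]_t g Z i t + primitive (g Z i) x.
Proof.
move=> bmZ; rewrite /S -(Rintegral_itvB (a := -oo%O)); last 3 first.
- by rewrite set_itvNyy; exact: ig.
- by [].
- by [].
by rewrite set_itvNyy opprB addrA addrAC.
Qed.

Let bmS Z : bounded_measurable Z -> bounded_measurable (S Z).
Proof.
move=> bmZ; split.
  move=> i; rewrite (_ : S Z i = fun x => c i - \int[mu]_t g Z i t + primitive (g Z i) x).
    apply: measurable_funD => //; apply: continuous_measurable_fun.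
    by apply/continuous_primitive/integrable_left_integrable; exact: ig.
  by apply/funext => x; exact: SE.
exists (\sum_i (`|c i| + \int[mu]_t `|g Z i t|)) => i x.
apply: (@le_trans _ _ (`|c i| + \int[mu]_t `|g Z i t|)); last first.
  by rewrite [leRHS](bigD1 i)//= lerDl; apply: sumr_ge0 => k _;
    rewrite addr_ge0// Rintegral_ge0.
apply: le_trans (ler_normB _ _) _; rewrite lerD2l.
have igx : mu.-integrable `]x, +oo[ (EFin \o g Z i) by apply: integrableS (ig i bmZ).
apply: le_trans (le_normr_Rintegral _ igx) _ => //.
rewrite -lee_fin /Rintegral !fineK.
- apply: ge0_subset_integral => //=; apply/measurable_EFinP.
  by apply: measurableT_comp => //; exact: mg.
- by apply: integrable_fin_num => //; exact: integrable_norm (ig i bmZ).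
- by apply: integrable_fin_num => //; exact: integrable_norm igx.
Qed.

(** The difference of the integrands is at most m t * (K * w t), and the inequality satisfied by the
    weight returns half of K * w x. *)
Let S_contraction (w : R -> R) (b K : R) Z Z' :
  measurable_fun setT w -> (forall x, 1 <= w x <= b) ->
  (forall x, \int[mu]_(t in `]x, +oo[) (m t * w t) <= w x / 2) ->
  bounded_measurable Z -> bounded_measurable Z' ->
  (forall j x, `|Z' j x - Z j x| <= K * w x) ->
  forall i x, `|S Z' i x - S Z i x| <= K / 2 * w x.
Proof.
move=> mw w1 hw bmZ bmZ' ZZ' i x.
have K0 : 0 <= K.
  have := le_trans (normr_ge0 _) (ZZ' i x); rewrite pmulr_lge0//.
  by rewrite (lt_le_trans ltr01)//; have /andP[] := w1 x.
have sub Y : bounded_measurable Y -> mu.-integrable `]x, +oo[ (EFin \o g Y i).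
  by move=> bY; apply: integrableS (ig i bY).
have imw : mu.-integrable `]x, +oo[ (EFin \o (fun t => m t * w t)).
  apply: (@integrableS _ _ _ _ setT) => //.
  apply: (le_integrable measurableT _ _ (integrableZr measurableT b im)).
    apply/measurable_EFinP; apply: measurable_funM => //.
    by have /measurable_int/measurable_EFinP := im.
  move=> t _ /=; rewrite lee_fin; have /andP[w1t wb] := w1 t.
  rewrite (le_trans _ (ler_norm _))// ger0_norm ?mulr_ge0// ?(le_trans ler01)//.
  by rewrite !ler_wpM2l.
have -> : S Z' i x - S Z i x =
    \int[mu]_(t in `]x, +oo[) g Z i t - \int[mu]_(t in `]x, +oo[) g Z' i t.
  by rewrite /S; ring.
rewrite -RintegralB//; last 2 first.
- exact: sub.
- exact: sub.
apply: le_trans (le_normr_Rintegral _ _) _ => //.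
  exact: (integrableB _ (sub _ bmZ) (sub _ bmZ')).
apply: (@le_trans _ _ (\int[mu]_(t in `]x, +oo[) (K * (m t * w t)))).
  apply: le_Rintegral => //.
  - by apply: integrable_norm; exact: (integrableB _ (sub _ bmZ) (sub _ bmZ')).
  - exact: integrableZl imw.
  move=> t _; rewrite (_ : _ - _ = g (fun j t => Z j t - Z' j t) i t).
    rewrite mulrCA; apply: g_le => j; rewrite distrC; exact: ZZ'.
  by rewrite /g -sumrB; apply: eq_bigr => j _; rewrite mulrBr.
by rewrite RintegralZl// mulrAC -mulrA ler_wpM2l.
Qed.

(** The tail integral is rewritten as total integral minus primitive, so that absolute continuity,
    the derivative almost everywhere and the limit [c i] at +oo can be read off from the facts on
    [primitive]. *)
Theorem Volterra_solution : exists Z : I -> R -> R,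
  [/\ forall i, mu.-integrable setT (EFin \o (fun t => \sum_j C i j t * Z j t)),
      exists B : R, forall i x, `|Z i x| <= B &
      forall i x, Z i x = c i - \int[mu]_t (\sum_j C i j t * Z j t) +
        primitive (fun t => \sum_j C i j t * Z j t) x].
Proof.
have [w [b [mw w1 hw]]] := Volterra_weight m_ge0 im.
pose Zk k := iter k S (fun i _ => c i).
have bmZ k : bounded_measurable (Zk k).
  elim: k => [|k ih]; last exact: bmS.
  split; first by move=> j; exact: measurable_cst.
  exists (\sum_i `|c i|) => i x; rewrite [leRHS](bigD1 i)//= lerDl.
  by apply: sumr_ge0.
have [_ [B0 Z0B]] := bmZ 0%N; have [_ [B1 Z1B]] := bmZ 1%N.
(* [K] bounds the first Picard increment; since w >= 1 it does so in the weighted norm too, and each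
   further iterate halves it. *)
pose K := `|B0| + `|B1|; have K0 : 0 <= K by rewrite addr_ge0.
have b1 : 1 <= b by have /andP[] := w1 0; exact: le_trans.
have dZ k : forall i x, `|Zk k.+1 i x - Zk k i x| <= K / 2 ^+ k * w x.
  elim: k => [|k ih] i x.
    have /andP[w1x _] := w1 x; rewrite expr0 divr1.
    rewrite (@le_trans _ _ K)// ?ler_peMr//.
    rewrite (le_trans (ler_normB _ _))// addrC lerD//.
      exact: le_trans (Z0B i x) (ler_norm _).
    exact: le_trans (Z1B i x) (ler_norm _).
  by rewrite exprSr invfM mulrA; exact: (S_contraction mw w1 hw (bmZ k) (bmZ k.+1)).
pose u i x : R^nat := telescope (fun k => Zk k i x).
have uG i x k : `|u i x k| <= geometric (K * b) 2^-1 k.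
  apply: le_trans (dZ k i x) _; rewrite /geometric/= exprVn mulrAC.
  by rewrite ler_wpM2r ?invr_ge0 ?exprn_ge0// ler_wpM2l//; have /andP[] := w1 x.
have half1 : `|2^-1 : R| < 1 by rewrite ger0_norm ?invr_ge0// invf_lt1// ltr1n.
have ZkE i x k : Zk k i x = Zk 0%N i x + series (u i x) k.
  by rewrite (eq_sum_telescope (fun k => Zk k i x)).
have cu i x : cvgn (series (u i x)).
  apply: normed_cvg; apply: series_le_cvg (@is_cvg_geometric_series _ (K * b) _ half1) => k.
  - exact: normr_ge0.
  - by rewrite geometric_ge0 ?mulr_ge0 ?invr_ge0// (le_trans ler01).
  - exact: uG.
have ZkB i x k : `|Zk k i x| <= B0 + K * b / (1 - 2^-1).
  rewrite ZkE (le_trans (ler_normD _ _))// lerD//.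
  rewrite (le_trans (ler_norm_sum _ _ _))//.
  apply: le_trans (geometric_le_lim k _ _ half1); last 2 first.
  - by rewrite mulr_ge0// (le_trans ler01).
  - by rewrite invr_gt0.
  by apply: ler_sum => j _; exact: uG.
pose Z i x := Zk 0%N i x + limn (series (u i x)).
have ZkZ i x : Zk k i x @[k --> \oo] --> Z i x.
  under eq_cvg do rewrite ZkE.
  by apply: cvgD; [exact: cvg_cst|exact: cu].
have ZB i x : `|Z i x| <= B0 + K * b / (1 - 2^-1).
  by apply: (cvgr_to_le (cvg_norm (ZkZ i x))); exact: nearW.
have gZ i (D : set R) : measurable D ->
    \int[mu]_(t in D) g (Zk k) i t @[k --> \oo] --> \int[mu]_(t in D) g Z i t.
  move=> mD.
  have [] := @Rintegral_dominated_cvg _ _ _ mu D (fun k => g (Zk k) i) (g Z i)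
    (fun t => m t * (B0 + K * b / (1 - 2^-1))) mD.
  - by move=> k; exact: measurable_funS (mg i (bmZ k)).
  - by move=> t _; apply: cvg_big => [|j _]; [exact: add_continuous|apply: cvgMr].
  - apply: (@integrableS _ _ _ _ setT) => //.
    exact: (integrableZr measurableT _ im).
  - by move=> k t _; exact: g_le.
  by [].
have mZ : bounded_measurable Z.
  split; last by eexists; exact: ZB.
  move=> j; apply: (@measurable_fun_cvg _ _ _ _ (fun k => Zk k j)).
    by move=> k; have [] := bmZ k.
  by move=> x _; exact: ZkZ.
exists Z; split; [by move=> i; exact: ig|by eexists; exact: ZB|move=> i x].
rewrite -[RHS](SE i x mZ).
(* Both sides of the fixed-point equation are limits of the shifted iterates: the left one by
   definition of [Z], the right one by dominated convergence inside [S]. *)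
have Zk1 : Zk k.+1 i x @[k --> \oo] --> Z i x.
  by rewrite (cvg_shiftS (fun k => Zk k i x)); exact: ZkZ.
apply: (cvg_unique _ Zk1); first exact: Rhausdorff.
by apply: cvgB; [exact: cvg_cst|exact: gZ].
Qed.

End Volterra.

(** * A smooth step function *)

Section Smooth.
Context {R : realType}.
Local Notation mu := (@lebesgue_measure R).
Implicit Types (f g : R -> R).

(** Derivatives are peeled off from the inside, so closure under sums, products and affine
    substitutions follows by induction on n with the functions generalised, without a Leibniz
    formula. *)
Fixpoint derivable_times (n : nat) f : Prop :=
  if n is n'.+1 then (forall x, derivable f x 1) /\ derivable_times n' f^`()
  else True.

Lemma derivable_timesW n f : derivable_times n.+1 f -> derivable_times n f.
Proof.
elim: n f => [//|n ih] f [df dn]; split => //; exact: ih.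
Qed.

Lemma derivable_times_smooth f : (forall n, derivable_times n f) ->
  forall n x, derivable f^`(n) x 1.
Proof.
move=> df n; have := df n.+1; elim: n f {df} => [|n ih] f [df dn] x //.
by rewrite derive1Sn; apply: ih.
Qed.

Lemma derivable_timesD n f g : derivable_times n f -> derivable_times n g ->
  derivable_times n (f \+ g).
Proof.
elim: n f g => [//|n ih] f g [df dnf] [dg dng]; split.
  by move=> x; apply: derivableD.
rewrite (_ : _^`() = f^`() \+ g^`()); first exact: ih.
by apply/funext => x; rewrite derive1E (deriveD (df x) (dg x)) /= !derive1E.
Qed.

Lemma derivable_timesM n f g : derivable_times n f -> derivable_times n g ->
  derivable_times n (f \* g).
Proof.
elim: n f g => [//|n ih] f g [df dnf] [dg dng]; split.
  by move=> x; apply: derivableM.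
rewrite (_ : _^`() = (f \* g^`()) \+ (g \* f^`())).
  by apply: derivable_timesD; apply: ih => //; apply: derivable_timesW.
by apply/funext => x; rewrite derive1E (deriveM (df x) (dg x)) /= !derive1E.
Qed.

Lemma derivable_times_cst n (c : R) : derivable_times n (cst c).
Proof.
elim: n c => [//|n ih] c; split; first by move=> x; exact: derivable_cst.
by rewrite (_ : _^`() = cst 0); [exact: ih|apply/funext => x; rewrite derive1_cst].
Qed.

Lemma derivable_times_affine n f (a b : R) : derivable_times n f ->
  derivable_times n (fun x => f (a * x + b)).
Proof.
have da (x : R) : is_derive x 1 (fun x : R => a * x + b) a.
  by apply: is_derive_eq; rewrite /GRing.scale/=; ring.
elim: n f => [//|n ih] f [df dnf].
have dfa (x : R) : is_derive x 1 (fun x => f (a * x + b)) (derive1 f (a * x + b) * a).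
  apply: (@is_derive1_comp _ f (fun x => a * x + b)).
  by rewrite derive1E; apply: derivableP.
split; first by move=> x; exact: ex_derive.
rewrite (_ : _^`() = cst a \* (fun x => derive1 f (a * x + b))).
  by apply: derivable_timesM; [exact: derivable_times_cst|exact: ih].
by apply/funext => x; rewrite derive1E derive_val mulrC.
Qed.

(** For n = 0 this is the classical smooth function e^(-1/x). The negative powers are included
    because the derivative of each member is a combination of two others, so one induction gives
    smoothness of the whole family. *)
Definition flat (n : nat) (x : R) : R :=
  if 0 < x then x ^- n * expR (- x^-1) else 0.

(** The exponential series gives e^(1/x) >= x^-(n+2) / (n+2)!. The bound is quadratic so that the
    derivative at 0 vanishes. *)
Lemma flat_le n x : `|flat n x| <= (n.+2)`!%:R * x ^+ 2.
Proof.
rewrite /flat; case: ltP => x0; last by rewrite normr0 mulr_ge0// sqr_ge0.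
rewrite ger0_norm ?mulr_ge0 ?expR_ge0 ?invr_ge0 ?exprn_ge0 ?(ltW x0)//.
rewrite expRN ler_pdivrMr ?expR_gt0//.
have e1 : x^-1 ^+ n.+2 <= (n.+2)`!%:R * expR x^-1.
  rewrite mulrC -ler_pdivrMr ?ltr0n ?fact_gt0//.
  apply: le_trans (expR_ge1Dxn n.+1 _); first by rewrite lerDr.
  by rewrite invr_ge0 ltW.
rewrite (_ : x ^- n = x^-1 ^+ n.+2 * x ^+ 2); last first.
  by rewrite -[n.+2]addn2 exprD -mulrA -exprMn mulVf ?gt_eqF// expr1n mulr1 exprVn.
by rewrite [leRHS]mulrAC ler_wpM2r// sqr_ge0.
Qed.

Lemma is_derive_flat n (x : R) :
  is_derive x 1 (flat n) (flat n.+2 x - n%:R * flat n.+1 x).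
Proof.
have [x0|x0|->] := ltgtP x 0.
- rewrite /flat ltNge (ltW x0)/= mulr0 subr0.
  apply: (@near_eq_is_derive _ _ _ (cst 0)).
    near=> y; rewrite /flat ltNge (_ : y <= 0)//.
    by apply: ltW; near: y; exact: lt_nbhsl.
- rewrite {2 3}/flat x0.
  have xV : is_derive x 1 (fun y : R => y^-1) (- x ^- 2).
    apply: DeriveDef; first by apply: derivableV; rewrite ?gt_eqF.
    by rewrite deriveV ?gt_eqF// derive_id /GRing.scale/= mulr1.
  apply: (@near_eq_is_derive R R R (fun y : R => y^-1 ^+ n * expR (- y^-1))).

  + near=> y; rewrite /flat (_ : 0 < y) ?exprVn//.
    by near: y; exact: lt_nbhsr.
  have xVn : is_derive x 1 (fun y : R => y^-1 ^+ n)
      (n%:R * x^-1 ^+ n.-1 * (- x ^- 2)).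
    have := is_deriveX n xV; rewrite (_ : _ ^+ n = fun y : R => y^-1 ^+ n) //.
    by apply/funext => y; rewrite fctE.
  have eV : is_derive x 1 (fun y : R => expR (- y^-1)) (expR (- x^-1) * x ^- 2).
    apply: (@is_derive1_comp _ expR (fun y : R => - y^-1)).
    by apply: is_derive_eq; rewrite opprK.
  apply: (is_derive_eq (is_deriveM xVn eV)); rewrite /GRing.scale/= -!exprVn.
  set E := expR _; set v := x^-1.
  (* The truncated predecessor in the power rule matters only for n = 0, where the factor n%:R
     annihilates that term. *)
  case: n xVn => [|n] _ /=; first by rewrite expr0; ring.
  by rewrite !exprS; ring.
have -> : flat n.+2 0 - n%:R * flat n.+1 0 = 0 :> R.
  by rewrite /flat ltxx mulr0 subrr.
(* By [flat_le] the difference quotient at 0 is at most K |h|. *)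
suff H : h^-1 *: ((flat n \o shift 0) (h *: 1) - flat n 0) @[h --> 0^'] --> (0 : R).
  by apply: DeriveDef; [apply/cvg_ex; exists 0|apply: cvg_lim].
pose K : R := (n.+2)`!%:R; have K0 : 0 < K by rewrite ltr0n fact_gt0.
apply/cvgr0Pnorm_lt => e e0; near=> h.
have h0 : h != 0 by near: h; exact: nbhs_dnbhs_neq.
have hK : `|h| < e / K.
  by near: h; apply: dnbhs0_lt; rewrite divr_gt0.
rewrite /= addr0 {2}/flat ltxx subr0 /GRing.scale/= mulr1 normrM normfV.
rewrite mulrC ltr_pdivrMr ?normr_gt0// (le_lt_trans (flat_le n h))// -/K.
rewrite -real_normK ?num_real// expr2 mulrA ltr_pM2r ?normr_gt0//.
by rewrite mulrC -ltr_pdivlMr.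
Unshelve. all: by end_near. Qed.

Lemma derivable_times_flat k n : derivable_times k (flat n).
Proof.
elim: k n => [//|k ih] n; split.
  by move=> x; have ? := is_derive_flat n x; exact: ex_derive.
rewrite (_ : _^`() = flat n.+2 \+ (cst (- n%:R) \* flat n.+1)).
  apply: derivable_timesD => //; apply: derivable_timesM => //.
  exact: derivable_times_cst.
apply/funext => x; have := is_derive_flat n x => ?.
by rewrite derive1E derive_val /= mulNr.
Qed.

Definition bump (x : R) : R := flat 0 x * flat 0 (1 - x).

Lemma derivable_times_bump n : derivable_times n bump.
Proof.
apply: derivable_timesM; first exact: derivable_times_flat.
rewrite (_ : (fun x => _) = (fun x => flat 0 (-1 * x + 1))).
  exact/derivable_times_affine/derivable_times_flat.
by apply/funext => x; rewrite mulN1r addrC.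
Qed.

Lemma continuous_bump : continuous bump.
Proof.
move=> x; apply: differentiable_continuous; apply/derivable1_diffP.
by have [] := derivable_times_bump 1.
Qed.

Lemma flat0_itv x : 0 <= flat 0 x <= 1.
Proof.
rewrite /flat; case: ltP => x0; rewrite ?lexx ?ler01//.
rewrite expr0 invr1 mul1r expR_ge0/= -[leRHS]expR0 ler_expR oppr_le0.
by rewrite invr_ge0 ltW.
Qed.

Lemma bump_itv x : 0 <= bump x <= 1.
Proof.
have /andP[f0 f1] := flat0_itv x; have /andP[g0 g1] := flat0_itv (1 - x).
by rewrite /bump mulr_ge0//= mulr_ile1.
Qed.

Lemma bump0 x : ~~ (0 < x < 1) -> bump x = 0.
Proof.
rewrite negb_and -!leNgt /bump /flat => /orP[x0|x1].
  by rewrite ltNge x0 mul0r.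
by rewrite subr_gt0 [X in _ * (if X then _ else _)]ltNge x1 mulr0.
Qed.

Lemma integrable_bump : mu.-integrable setT (EFin \o bump).
Proof.
have mb : measurable_fun setT bump.
  exact: continuous_measurable_fun continuous_bump.
have := @integrable_indic_itv R 0 1 true false.
apply: le_integrable => //; first exact/measurable_EFinP.
move=> x _ /=; rewrite lee_fin; have /andP[b0 b1] := bump_itv x.
rewrite ger0_norm// indicE ger0_norm ?ler0n//.
have [xi|xi] := boolP (x \in _); first by rewrite b1.
rewrite bump0//; apply: contra xi => /andP[x0 x1].
by rewrite inE/= in_itv/= !ltW.
Qed.

Let P := primitive bump.

Let derive_P (x : R) : is_derive x 1 P (bump x).
Proof.
have [d <-] := @continuous_FTC1 _ bump -oo%O x (x + 1) (ltr_pwDr ltr01 (lexx x))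
  (integrable_left_integrable integrable_bump _) (ltNyr _) (@continuous_bump x).
by rewrite derive1E; exact: derivableP.
Qed.

Let P_mono x y : x <= y -> P x <= P y.
Proof.
move=> xy; rewrite -subr_ge0 /P primitiveB//; last first.
  exact: integrable_left_integrable integrable_bump.
by apply: Rintegral_ge0 => t _; have /andP[] := bump_itv t.
Qed.

Let P0 x : x <= 0 -> P x = 0.
Proof.
move=> x0; rewrite /P /primitive.
rewrite (@eq_Rintegral _ _ _ _ _ (cst 0)) ?Rintegral_cst ?mul0r// => t.
rewrite inE/= in_itv/= => tx; apply: bump0.
by rewrite ltNge (le_trans tx).
Qed.

Let P1 x : 1 <= x -> P x = P 1.
Proof.
move=> x1; apply/eqP; rewrite -subr_eq0 /P primitiveB//; last first.
  exact: integrable_left_integrable integrable_bump.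
apply/eqP; rewrite (@eq_Rintegral _ _ _ _ _ (cst 0)) ?Rintegral_cst ?mul0r// => t.
rewrite inE/= in_itv/= => /andP[tx _]; apply: bump0.
by rewrite (ltNge t) (ltW tx) andbF.
Qed.

(** [P] is monotone, so P 1 = 0 would make it identically 0, while its derivative [bump] is positive
    at 1/2. *)
Let P1_gt0 : 0 < P 1.
Proof.
rewrite lt_neqAle -(P0 (lexx 0)) P_mono ?ler01// andbT (P0 (lexx 0)).
apply/eqP => P10.
have Pc : P = cst 0.
  apply/funext => x; have [x0|x0] := leP x 0; first exact: P0.
  apply/le_anti; rewrite -{2}(P0 (lexx 0)) P_mono ?(ltW x0)// andbT P10.
  by have [x1|x1] := leP x 1; [exact: P_mono|rewrite P1// ltW].
have : bump 2^-1 = 0.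
  by have [_ <-] := derive_P 2^-1; rewrite Pc; exact: derive_cst.
apply/eqP; rewrite gt_eqF// /bump /flat.
have -> : 1 - 2^-1 = 2^-1 :> R by field.
by rewrite invr_gt0 ltr0n expr0 invr1 mul1r mulr_gt0 ?expR_gt0.
Qed.

(** The primitive of the bump, normalised by its total mass. The bound on the derivative is what
    later compares the rescaled kernel with averages over balls. *)
Lemma smooth_step : exists Phi : R -> R,
  [/\ forall n, derivable_times n Phi,
      forall x, x <= 0 -> Phi x = 0,
      forall x, 1 <= x -> Phi x = 1,
      forall x, 0 <= Phi x <= 1 &
      exists2 B : R, forall x, `|derive1 Phi x| <= B &
        forall x, ~~ (0 < x < 1) -> derive1 Phi x = 0].
Proof.
pose k := (P 1)^-1; have k0 : 0 < k by rewrite invr_gt0.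
have dPhi (x : R) : is_derive x 1 (fun x => k * P x) (k * bump x).
  by have := derive_P x => ?; exact: is_deriveZ.
have dE : (fun x => k * P x)^`() = cst k \* bump.
  by apply/funext => x; rewrite derive1E derive_val.
exists (fun x => k * P x); split.
- case=> [//|n]; split; first by move=> x; exact: ex_derive.
  rewrite dE; apply: derivable_timesM; first exact: derivable_times_cst.
  exact: derivable_times_bump.
- by move=> x x0; rewrite P0// mulr0.
- by move=> x x1; rewrite P1// mulVf// gt_eqF.
- move=> x; have [x0|x0] := leP x 0; first by rewrite P0// mulr0 lexx ler01.
  rewrite mulr_ge0 ?(ltW k0)//=; last by rewrite -(P0 (lexx 0)) P_mono// ltW.
  rewrite mulrC ler_pdivrMr// mul1r.
  by have [x1|x1] := leP x 1; [exact: P_mono|rewrite P1// ltW].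
exists k.
  move=> x; rewrite dE/=; have /andP[b0 b1] := bump_itv x.
  by rewrite ger0_norm ?(mulr_ge0 (ltW k0) b0)// ler_piMr// ltW.
by move=> x x01; rewrite dE/= bump0// mulr0.
Qed.

End Smooth.

(** * The du Bois-Reymond lemma *)

Section DuBoisReymond.
Context {R : realType}.
Local Notation mu := (@lebesgue_measure R).

(** The vanishing of [psi] beyond [a] makes up for the missing integrability of [w] at +oo. *)
Lemma integrable_mul_left_bounded (w psi : R -> R) (a K : R) :
  left_integrable w -> measurable_fun setT psi ->
  (forall t, `|psi t| <= K) -> (forall t, a < t -> psi t = 0) ->
  mu.-integrable setT (EFin \o (fun t => w t * psi t)).
Proof.
move=> iw mpsi psiK psi0.
have K0 : 0 <= K by apply: le_trans (psiK 0).
have iwa : mu.-integrable setT (EFin \o (w \_ `]-oo, a])).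
  by have /integrable_mkcond := iw a; rewrite restrict_EFin; apply.
apply: (le_integrable measurableT _ _ (integrableZr measurableT K iwa)).
  have [mw _ _] := left_integrable_locally iw.
  by apply/measurable_EFinP; exact: measurable_funM.
move=> t _ /=; rewrite lee_fin !normrM (ger0_norm K0) patchE.
have [ta|ta] := leP t a.
  by rewrite mem_set/= ?in_itv//= ler_wpM2l.
by rewrite psi0// normr0 mulr0 mulr_ge0.
Qed.

Variables (Phi : R -> R) (B : R).
Hypothesis dPhi : forall n, derivable_times n Phi.
Hypothesis Phi0 : forall x, x <= 0 -> Phi x = 0.
Hypothesis Phi1 : forall x, 1 <= x -> Phi x = 1.
Hypothesis Phi_itv : forall x, 0 <= Phi x <= 1.
Hypothesis dPhiB : forall x, `|derive1 Phi x| <= B.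
Hypothesis dPhi0 : forall x, ~~ (0 < x < 1) -> derive1 Phi x = 0.

(** A transition from 0 to 1 across [x, x + e]; its derivative [kernel] is a one-sided approximate
    identity at x. The affine argument is written in the shape required by
    [derivable_times_affine]. *)
Let step (e x t : R) := Phi (e^-1 * t + (- (e^-1 * x))).
Let kernel (e x t : R) := e^-1 * derive1 Phi (e^-1 * t + (- (e^-1 * x))).

Let is_derive_step (e x t : R) : is_derive t 1 (step e x) (kernel e x t).
Proof.
rewrite /kernel mulrC.
apply: (@is_derive1_comp _ Phi (fun t => e^-1 * t + (- (e^-1 * x)))).
  by rewrite derive1E; apply: derivableP; have [] := dPhi 1.
by apply: is_derive_eq; rewrite /GRing.scale/=; ring.
Qed.

Let argE (e x t : R) : e^-1 * t + (- (e^-1 * x)) = (t - x) / e.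
Proof. by rewrite -mulrBr mulrC. Qed.

Let step0 (e x t : R) : 0 < e -> t <= x -> step e x t = 0.
Proof.
by move=> e0 tx; rewrite /step argE Phi0// ler_pdivrMr// mul0r subr_le0.
Qed.

Let step1 (e x t : R) : 0 < e -> x + e <= t -> step e x t = 1.
Proof.
by move=> e0 tx; rewrite /step argE Phi1// ler_pdivlMr// mul1r; lra.
Qed.

Let kernel0 (e x t : R) : 0 < e -> ~~ (x < t < x + e) -> kernel e x t = 0.
Proof.
move=> e0 tx; rewrite /kernel argE dPhi0 ?mulr0//.
by apply: contra tx; rewrite ltr_pdivlMr// ltr_pdivrMr//; lra.
Qed.

Let kernelB (e x t : R) : 0 < e -> `|kernel e x t| <= B / e.
Proof.
by move=> e0; rewrite normrM gtr0_norm ?invr_gt0// mulrC ler_wpM2r// invr_ge0 ltW.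
Qed.

Let continuous_kernel (e x : R) : continuous (kernel e x).
Proof.
move=> t; apply: cvgMr.
apply: (@continuous_comp _ _ _ (fun t => e^-1 * t + (- (e^-1 * x))) (derive1 Phi)).
  apply: cvgD; last exact: cvg_cst.
  by apply: cvgMr; exact: cvg_id.
apply: differentiable_continuous; apply/derivable1_diffP.
by have [_ []] := dPhi 2.
Qed.

Let measurable_kernel (e x : R) : measurable_fun setT (kernel e x).
Proof. by apply: continuous_measurable_fun; exact: continuous_kernel e x. Qed.

Let continuous_step (e x : R) : continuous (step e x).
Proof.
move=> t; apply: differentiable_continuous; apply/derivable1_diffP.
by have ? := is_derive_step e x t; exact: ex_derive.
Qed.

Let measurable_step (e x : R) : measurable_fun setT (step e x).
Proof. by apply: continuous_measurable_fun; exact: continuous_step e x. Qed.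

Let integral_kernel (e x : R) : 0 < e -> \int[mu]_t kernel e x t = 1.
Proof.
move=> e0.
transitivity (\int[mu]_(t in `[x, x + e]) kernel e x t).
  rewrite [RHS]Rintegral_mkcond; apply: eq_Rintegral => t _.
  rewrite patchE; case: ifPn => //; rewrite notin_setE/= in_itv/= => /negP tx.
  by apply: kernel0 => //; apply: contra tx => /andP[? ?]; rewrite !ltW.
rewrite /Rintegral (@continuous_FTC2 _ _ (step e x)).
- by rewrite step1// step0//= subr0.
- by rewrite ltrDl.
- apply: continuous_subspaceT => t; exact: continuous_kernel.
- split.
  + by move=> t _; have ? := is_derive_step e x t; exact: ex_derive.
  + by apply: cvg_at_right_filter; exact: continuous_step.
  + by apply: cvg_at_left_filter; exact: continuous_step.
- move=> t _; have ? := is_derive_step e x t.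
  by rewrite derive1E derive_val.
Qed.

Let integrable_kernel (w : R -> R) (e x : R) : 0 < e -> left_integrable w ->
  mu.-integrable setT (EFin \o (fun t => w t * kernel e x t)).
Proof.
move=> e0 iw; apply: (integrable_mul_left_bounded (a := x + e) iw).
- exact: measurable_kernel.
- by move=> t; exact: kernelB.
- move=> t xt; apply: kernel0 => //.
  by apply/negP => /andP[_]; rewrite ltNge (ltW xt).
Qed.

(** The kernel has mass 1, is bounded by B / e and lives in the ball of radius 2 e around x. That
    ball has measure 4 e, and B / e = 4 B / (4 e). *)
Let kernel_davg (w : R -> R) (e x : R) : 0 < e -> left_integrable w ->
  (`|\int[mu]_t (w t * kernel e x t) - w x|%:E <= (4 * B)%:E * davg w x (2 * e))%E.
Proof.
move=> e0 iw.
have B0 : 0 <= B by apply: le_trans (dPhiB 0).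
have ik : mu.-integrable setT (EFin \o kernel e x).
  (* The indicator of the support stands in for the constant 1, which is not integrable at -oo. *)
  have H := @integrable_mul_left_bounded (\1_(`[x, x + e]%classic)) (kernel e x)
    (x + e) (B / e).
  apply: eq_integrable (H _ _ _ _) => //.
  - move=> t _ /=; rewrite indicE; have [_|tx] := boolP (t \in _); first by rewrite mul1r.
    rewrite mul0r kernel0//; apply: contra tx => /andP[? ?].
    by rewrite inE/= in_itv/= !ltW.
  - exact: integrable_left_integrable (integrable_indic_itv _ _ _ _).
  - by move=> t; exact: kernelB.
  - move=> t xt; apply: kernel0 => //.
    by apply/negP => /andP[_]; rewrite ltNge (ltW xt).
have iwk := integrable_kernel x e0 iw.
have ick : mu.-integrable setT (EFin \o (fun t => w x * kernel e x t)).
  exact: (integrableZl measurableT (w x) ik).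
have -> : \int[mu]_t (w t * kernel e x t) - w x =
    \int[mu]_t (w t * kernel e x t - w x * kernel e x t).
  by rewrite RintegralB// RintegralZl// integral_kernel// mulr1.
have [mw _ _] := left_integrable_locally iw.
rewrite EFin_normr_Rintegral//; last exact: (integrableB measurableT iwk ick).
apply: (le_trans (le_abse_integral _ _ _)) => //.
  exact: measurable_int _ (integrableB measurableT iwk ick).
rewrite /davg /iavg lebesgue_measure_ball ?mulr_ge0 ?(ltW e0)//.
rewrite inver mulrn_eq0/= mulf_eq0 pnatr_eq0/= (gt_eqF e0) muleA -EFinM.
rewrite (_ : 4 * B * _ = B / e); last by field; rewrite gt_eqF.
rewrite -ge0_integralZl_EFin ?divr_ge0 ?(ltW e0)//; last 2 first.
- exact: measurable_ball.
- apply/measurable_EFinP; apply: measurableT_comp => //.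
  by apply: measurable_funB => //; exact: measurable_funS mw.
rewrite [leRHS]integral_mkcond; apply: ge0_le_integral => //=.
- apply/measurable_EFinP; apply: measurableT_comp => //.
  by apply: measurable_funB; apply: measurable_funM => //; exact: measurable_kernel.
- apply/(measurable_restrictT _ _).1; first exact: measurable_ball.
  apply/measurable_EFinP; apply: measurable_funM => //; apply: measurableT_comp => //.
  by apply: measurable_funB => //; exact: measurable_funS mw.
move=> t _; rewrite patchE -mulrBl normrM.
have [tx|tx] := boolP (x < t < x + e); last first.
  rewrite kernel0// normr0 mulr0; case: ifPn => // _.
  by rewrite lee_fin mulr_ge0// divr_ge0// ltW.
rewrite mem_set; last first.
  by rewrite /ball/= ltr_distlC; lra.
by rewrite lee_fin mulrC ler_wpM2r//; exact: kernelB.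
Qed.

Let e_ (n : nat) : R := n.+1%:R^-1.

Let e_gt0 n : 0 < e_ n. Proof. by rewrite invr_gt0 ltr0n. Qed.

Let near_e (d : R) : 0 < d -> \forall n \near \oo, e_ n < d.
Proof.
move=> d0; have /cvgrPdist_lt/(_ _ d0) := @cvg_harmonic R.
by apply: filterS => n; rewrite sub0r normrN gtr0_norm.
Qed.

Let cvg_kernel (w : R -> R) (x : R) : left_integrable w -> lebesgue_pt w x ->
  \int[mu]_t (w t * kernel (e_ n) x t) @[n --> \oo] --> w x.
Proof.
move=> iw wx; have B0 : 0 <= B by apply: le_trans (dPhiB 0).
apply/cvgrPdist_le => d d0.
(* The summand 1 keeps the divisor positive, as [B] is only known to be nonnegative. *)
have k0 : 0 < d / (4 * B + 1) by rewrite divr_gt0// ltr_wpDl// mulr_ge0.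
have [r /= r0 wr] : \forall r \near 0^'+, (davg w x r <= (d / (4 * B + 1))%:E)%E.
  move/fine_cvgP : wx => [wfin /cvgrPdist_le/(_ _ k0)].
  apply: filterS2 wfin => r /= wr; rewrite sub0r normrN => H.
  by rewrite -(fineK wr) lee_fin (le_trans (ler_norm _)).
near=> n; rewrite -lee_fin distrC.
apply: le_trans (kernel_davg x (e_gt0 n) iw) _.
have enr : 2 * e_ n < r.
  rewrite mulrC -ltr_pdivlMr//; near: n.
  by apply: near_e; rewrite divr_gt0.
apply: (@le_trans _ _ ((4 * B)%:E * (d / (4 * B + 1))%:E)%E).
  apply: lee_wpmul2l; first by rewrite lee_fin mulr_ge0.
  apply: wr; last by rewrite mulr_gt0.
  by rewrite /= sub0r normrN gtr0_norm// mulr_gt0.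
rewrite -EFinM lee_fin mulrCA ler_piMr ?(ltW d0)//.
by rewrite ler_pdivrMr ?mul1r ?lerDl// ltr_wpDl// mulr_ge0.
Unshelve. all: by end_near. Qed.

(* The test functions are smooth approximations of the indicator of ]x, y]. *)
Lemma lebesgue_pt_du_Bois_Reymond (w h : R -> R) (x y : R) :
  left_integrable w -> left_integrable h ->
  (forall phi, test_function phi ->
    \int[mu]_t (w t * derive1 phi t) = - \int[mu]_t (h t * phi t)) ->
  0 < x -> x < y -> lebesgue_pt w x -> lebesgue_pt w y ->
  w y - w x = primitive h y - primitive h x.
Proof.
move=> iw ih wh x0 xy wx wy.
pose phi n t := step (e_ n) x t - step (e_ n) y t.
have dphi n (t : R) : is_derive t 1 (phi n) (kernel (e_ n) x t - kernel (e_ n) y t).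
  have ? := is_derive_step (e_ n) x t; have ? := is_derive_step (e_ n) y t.
  exact: is_deriveB.
have tphi n : test_function (phi n).
  split.
    apply: derivable_times_smooth => k.
    rewrite (_ : phi n = (fun t => step (e_ n) x t) \+
        (cst (-1) \* (fun t => step (e_ n) y t))); last first.
      by apply/funext => t /=; rewrite mulN1r.
    apply: derivable_timesD; first exact: derivable_times_affine.
    apply: derivable_timesM; first exact: derivable_times_cst.
    exact: derivable_times_affine.
  exists x, (y + e_ n); split => // t; rewrite notin_setE/= in_itv/= => /negP.
  rewrite negb_and -!ltNge => /orP[tx|yt].
    by rewrite /phi !step0 ?subrr// ltW// (lt_trans tx).
  by rewrite /phi !step1 ?subrr// ltW//; have := e_gt0 n; lra.
have L : \int[mu]_t (w t * derive1 (phi n) t) @[n --> \oo] --> w x - w y.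
  rewrite (_ : (fun n => _) = (fun n => \int[mu]_t (w t * kernel (e_ n) x t) -
      \int[mu]_t (w t * kernel (e_ n) y t))); last first.
    apply/funext => n; rewrite -RintegralB//; last 2 first.
    - exact: integrable_kernel.
    - exact: integrable_kernel.
    apply: eq_Rintegral => t _; have ? := dphi n t.
    by rewrite derive1E derive_val mulrBr.
  by apply: cvgB; exact: cvg_kernel.
have D : (- \int[mu]_t (h t * phi n t)) @[n --> \oo] -->
    - (primitive h y - primitive h x).
  apply: cvgN; rewrite primitiveB ?(ltW xy)// Rintegral_mkcond.
  have [mh _ _] := left_integrable_locally ih.
  (* All supports end before y + 1 because e_n <= 1, which gives a common dominating function. *)
  have ihy : mu.-integrable setT (EFin \o (Num.norm \o (h \_ `]-oo, y + 1]))).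
    apply: integrable_norm.
    by have /integrable_mkcond := ih (y + 1); rewrite restrict_EFin; apply.
  have [] := @Rintegral_dominated_cvg _ _ _ mu setT (fun n t => h t * phi n t)
    (h \_ `]x, y]) _ measurableT _ _ ihy _ => //.
  - move=> n; apply: measurable_funM => //; apply: measurable_funB => //;
      exact: measurable_step.
  (* At each t the sequence is eventually stationary. The transitions take place to the right of x
     and of y, which is why the limit is the indicator of ]x, y], closed at y. *)
  - move=> t _; apply: cvg_near_cst.
    have [tx|xt] := leP t x.
      apply: nearW => n; rewrite patchE memNset/=; last by rewrite in_itv/= ltNge tx.
      by rewrite /phi !step0 ?subrr ?mulr0// (le_trans tx)// ltW.
    have [ty|yt] := leP t y.
      near=> n; rewrite patchE mem_set/= ?in_itv/= ?xt//.
      rewrite /phi (step0 _ ty)// step1// ?subr0 ?mulr1// -lerBrDl; apply: ltW.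
      by near: n; apply: near_e; rewrite subr_gt0.
    near=> n; rewrite patchE memNset/=; last by rewrite in_itv/= xt leNgt yt.
    have : e_ n < t - y.
      by near: n; apply: near_e; rewrite subr_gt0.
    by move=> enty; rewrite /phi !step1 ?subrr ?mulr0//; lra.
  - move=> n t _; rewrite normrM /= patchE.
    have [ty|ty] := leP t (y + 1).
      rewrite mem_set/= ?in_itv//= ler_piMr//.
      have := Phi_itv ((e_ n)^-1 * t + (- ((e_ n)^-1 * x))).
      have := Phi_itv ((e_ n)^-1 * t + (- ((e_ n)^-1 * y))).
      by rewrite /phi /step ler_norml; lra.
    have e1 : e_ n <= 1 by rewrite invf_le1// ler1n.
    have -> : phi n t = 0 by rewrite /phi !step1 ?subrr//; lra.
    by rewrite normr0 mulr0.
have : w x - w y = - (primitive h y - primitive h x).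
  move: L; rewrite (_ : (fun n => _) = (fun n => - \int[mu]_t (h t * phi n t))).
    by move=> L; apply: (cvg_unique _ L D); exact: Rhausdorff.
  by apply/funext => n; rewrite wh.
by lra.
Unshelve. all: by end_near. Qed.

End DuBoisReymond.

Theorem du_Bois_Reymond (R : realType) (w h : R -> R) :
  left_integrable w -> left_integrable h ->
  (forall phi, test_function phi ->
    \int[@lebesgue_measure R]_t (w t * derive1 phi t) =
    - \int[@lebesgue_measure R]_t (h t * phi t)) ->
  exists c : R, {ae @lebesgue_measure R, forall x, 0 < x ->
    w x = c + primitive h x}.
Proof.
move=> iw ih wh; have [Phi [dPhi Phi0 Phi1 Phi_itv [B dPhiB dPhi0]]] := @smooth_step R.
have DBR := lebesgue_pt_du_Bois_Reymond dPhi Phi0 Phi1 Phi_itv dPhiB dPhi0 iw ih wh.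
have ae_pt := lebesgue_differentiation (left_integrable_locally iw).
(* One positive Lebesgue point serves as base point and fixes c. If there were none, the claim would
   hold vacuously at every Lebesgue point, hence almost everywhere. *)
have [[x0 [x00 wx0]]|no_pt] := pselect (exists x, 0 < x /\ lebesgue_pt w x); last first.
  exists 0; move: ae_pt.
  apply: filterS; first exact: (ae_filter_ringOfSetsType (@lebesgue_measure R)).
  move=> x wx x0; by exfalso; apply: no_pt; exists x.
exists (w x0 - primitive h x0); move: ae_pt.
apply: filterS; first exact: (ae_filter_ringOfSetsType (@lebesgue_measure R)).
move=> x wx x_gt0.
have [xx0|xx0|->] := ltgtP x x0.
- by have := DBR _ _ x_gt0 xx0 wx wx0; lra.
- by have := DBR _ _ x00 xx0 wx0 wx; lra.
- by rewrite subrK.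
Qed.

(** * Amalgam norms *)

Section UnitNorms.
Context {R : realType}.
Local Notation mu := (@lebesgue_measure R).
Implicit Types (f : R -> R) (x : R).

Definition unit_integral f x : \bar R :=
  (\int[mu]_(t in `]x, (x + 1)%R[) `|f t|%:E)%E.

Lemma unit_integral_ge0 f x : (0 <= unit_integral f x)%E.
Proof. by apply: integral_ge0 => t _; rewrite lee_fin. Qed.

Lemma unit_cutE f x : unit_cut f x = f \_ `]x, x + 1[.
Proof.
by apply/funext => t; rewrite /unit_cut patchE indicE; case: ifPn; rewrite ?mulr1 ?mulr0.
Qed.

Lemma unit_norm1E f x : unit_norm 1 f x = unit_integral f x.
Proof.
rewrite /unit_norm Lnorm1 /unit_integral [RHS]integral_mkcond.
by apply: eq_integral => t _; rewrite /= unit_cutE !patchE; case: ifPn; rewrite ?normr0.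
Qed.

Lemma measurable_unit_cut f x : 0 <= x ->
  measurable_fun (`[0, +oo[ : set R) f -> measurable_fun setT (unit_cut f x).
Proof.
move=> x0 mf; rewrite unit_cutE; apply/(measurable_restrictT _ _).1 => //.
apply: measurable_funS mf => // t; rewrite /= !in_itv/= andbT => /andP[xt _].
by rewrite (le_trans x0)// ltW.
Qed.

(* Cauchy-Schwarz against the indicator of an interval of length 1. *)
Lemma unit_integral_le_norm2 f x : 0 <= x ->
  measurable_fun (`[0, +oo[ : set R) f ->
  (unit_integral f x <= unit_norm 2 f x)%E.
Proof.
move=> x0 mf; rewrite -unit_norm1E.
have mA : measurable (`]x, (x + 1)%R[%classic : set R) by [].
have half : 2^-1 + 2^-1 = 1 :> R by field.
have := hoelder mu (measurable_unit_cut x0 mf) (measurable_indic mA)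
  (ltr0n R 2) (ltr0n R 2) half.
rewrite (_ : 'N[mu]_1[_] = unit_norm 1 f x)%E; last first.
  apply: eq_Lnorm => t /=; rewrite /unit_cut indicE; case: (_ \in _).
    by rewrite !mulr1.
  by rewrite !mulr0.
rewrite (_ : 'N[mu]_2%:E[EFin \o \1_(`]x, (x + 1)%R[%classic)] = 1)%E ?mule1//.
rewrite unlock /=.
have -> : (\int[mu]_t `|(\1_(`]x, (x + 1)%R[%classic : set R) t)%:E| `^ 2 =
    \int[mu]_t (\1_(`]x, (x + 1)%R[%classic : set R) t)%:E)%E.
  apply: eq_integral => t _ /=; rewrite indicE; case: (_ \in _).
    by rewrite normr1 powR1.
  by rewrite normr0 powR0// pnatr_eq0.
rewrite integral_indic// setIT [X in (X `^ _)%E](lebesgue_measure_itv `]x, x + 1[%R)/=.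
by rewrite lte_fin ltrDl ltr01 -EFinB addrAC subrr add0r /= powR1.
Qed.

Lemma unit_norm2_sqr f x :
  unit_integral (fun t => f t ^+ 2) x = (unit_norm 2 f x * unit_norm 2 f x)%E.
Proof.
have -> : (unit_norm 2 f x * unit_norm 2 f x = unit_norm 2 f x `^ 2)%E.
  have := Lnorm_ge0 mu 2%:E (EFin \o unit_cut f x); rewrite -/(unit_norm 2 f x).
  case: (unit_norm 2 f x) => [r| |]//.
    by rewrite lee_fin => r0; rewrite poweR_EFin powR_mulrn// expr2.
  by move=> _; rewrite poweRyr ?pnatr_eq0// mulyy.
rewrite /unit_norm poweR_Lnorm ?pnatr_eq0// /unit_integral [LHS]integral_mkcond.
apply: eq_integral => t _; rewrite /= unit_cutE !patchE; case: ifPn => _ /=.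
  by rewrite powR_mulrn// normrX.
by rewrite normr0 powR0// pnatr_eq0.
Qed.

Lemma itv0y_bigcup :
  `[0%R, +oo[%classic = \bigcup_(n : nat) `[n%:R, n.+1%:R[%classic :> set R.
Proof.
apply/seteqP; split => x /=; rewrite ?in_itv/=.
  rewrite andbT => x0; exists (Num.trunc x) => //=.
  by rewrite in_itv/=; exact: trunc_itv.
by move=> [n _] /=; rewrite in_itv/= andbT => /andP[+ _]; exact: le_trans.
Qed.

Lemma trivIset_unit_itv :
  trivIset setT (fun n : nat => `[n%:R, n.+1%:R[%classic : set R).
Proof.
move=> i j _ _ [x []] /=; rewrite !in_itv/= => /andP[ix xi] /andP[jx xj].
have := le_lt_trans ix xj; have := le_lt_trans jx xi.
by rewrite !ltr_nat !ltnS => ji ij; apply/eqP; rewrite eqn_leq ij ji.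
Qed.

(** The norms use open unit intervals, whereas a partition of the half-line needs half-open cells;
    the extra endpoint is a null set. *)
Lemma unit_integral_nat f (n : nat) : measurable_fun (`[0, +oo[ : set R) f ->
  (\int[mu]_(t in `[n%:R, n.+1%:R[) `|f t|%:E = unit_integral f n%:R)%E.
Proof.
move=> mf; rewrite /unit_integral -natr1.
rewrite integral_itv_bndoo//; apply/measurable_EFinP.
apply: measurableT_comp => //; apply: measurable_funS mf => //.
move=> t /=; rewrite !in_itv/= andbT => /andP[nt _].
by rewrite (le_trans (ler0n _ n))// ltW.
Qed.

Lemma integrable_sum_unit_integral f : measurable_fun (`[0, +oo[ : set R) f ->
  (\sum_(0 <= n <oo) unit_integral f n%:R < +oo)%E ->
  mu.-integrable `[0, +oo[ (EFin \o f).
Proof.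
move=> mf sf; apply/integrableP; split; first exact/measurable_EFinP.
rewrite itv0y_bigcup ge0_integral_bigcup; last 4 first.
- by [].
- by rewrite -itv0y_bigcup; apply/measurable_EFinP; exact: measurableT_comp.
- by [].
- exact: trivIset_unit_itv.
by under eq_eseriesr do rewrite unit_integral_nat//.
Qed.

Lemma left_integrable_unit_integral f : measurable_fun (`[0, +oo[ : set R) f ->
  (forall n : nat, unit_integral f n%:R < +oo)%E ->
  left_integrable (f \_ `[0, +oo[).
Proof.
move=> mf uf.
have fn (n : nat) : (\int[mu]_(t in `[0%R, n%:R[) `|f t|%:E < +oo)%E.
  elim: n => [|n ih]; first by rewrite set_itvco0 integral_set0.
  rewrite (@itv_bndbnd_setU _ _ _ (BLeft n%:R)) ?bnd_simp ?ler_nat//.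
  rewrite ge0_integral_setU//=.
  - by rewrite unit_integral_nat// lte_add_pinfty.
  - apply/measurable_EFinP; apply: measurableT_comp => //.
    apply: measurable_funS mf => // t /= [] /=; rewrite !in_itv/= andbT => /andP[]//.
    by move=> nt _; rewrite (le_trans _ nt).
  - apply/disj_setPS => t [] /=; rewrite !in_itv/= => /andP[_ tn] /andP[nt _].
    by move: (lt_le_trans tn nt); rewrite ltxx.
move=> y; rewrite -restrict_EFin; apply/integrable_restrict => //.
apply/integrableP; split.
  by apply/measurable_EFinP; apply: measurable_funS mf.
apply: le_lt_trans (fn (Num.trunc `|y|).+1); apply: ge0_subset_integral => //=.
- by apply: measurableI.
- apply/measurable_EFinP; apply: measurableT_comp => //.
  by apply: measurable_funS mf => // t /=; rewrite !in_itv/= andbT => /andP[].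
- move=> t [] /=; rewrite !in_itv/= andbT => ty ->/=.
  rewrite (le_lt_trans ty)// (le_lt_trans (ler_norm _))//.
  by have /andP[] := trunc_itv (normr_ge0 y).
Qed.

Lemma lpLq1_integrable f : lpLq 1 1 f -> mu.-integrable `[0, +oo[ (EFin \o f).
Proof.
move=> [mf sf]; apply: integrable_sum_unit_integral => //.
apply: le_lt_trans sf; apply: lee_nneseries => n _; first by rewrite unit_integral_ge0.
by rewrite unit_norm1E poweRe1 ?unit_integral_ge0.
Qed.

Lemma lpLq2_integrable f : lpLq 1 2 f -> mu.-integrable `[0, +oo[ (EFin \o f).
Proof.
move=> [mf sf]; apply: integrable_sum_unit_integral => //.
apply: le_lt_trans sf; apply: lee_nneseries => n _; first by rewrite unit_integral_ge0.
by rewrite poweRe1 ?unit_integral_le_norm2// Lnorm_ge0.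
Qed.

(** The inclusion of l^1 in l^2: each term N_n is at most the sum S, so the sum of the N_n^2 is at
    most S * S. *)
Lemma lpLq2_integrable_sqr f : lpLq 1 2 f ->
  mu.-integrable `[0, +oo[ (EFin \o (fun t => f t ^+ 2)).
Proof.
move=> [mf]; under eq_eseriesr do rewrite poweRe1 ?Lnorm_ge0//.
set N := unit_norm 2 f; set S := (\sum_(_ <= _ <oo) _)%E => Soo.
have N0 n : (0 <= N n%:R)%E by exact: Lnorm_ge0.
have S0 : (0 <= S)%E by exact: nneseries_ge0.
apply: integrable_sum_unit_integral; first exact: measurable_funX.
have NS n : (N n%:R <= S)%E.
  apply: le_trans (nneseries_lim_ge n.+1 _) => //.
  by rewrite big_nat_recr//= leeDr// sume_ge0.
have Sfin : S = (fine S)%:E by rewrite fineK// ge0_fin_numE.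
apply: (@le_lt_trans _ _ (\sum_(0 <= n <oo) ((fine S)%:E * N n%:R))%E).
  apply: lee_nneseries => n _; first by rewrite unit_integral_ge0.
  by rewrite unit_norm2_sqr -Sfin lee_wpmul2r// NS.
by rewrite nneseriesZl// -/S Sfin -EFinM ltry.
Qed.

Lemma uniformly_locally_lty q f x : uniformly_locally_Lq q f -> 0 <= x ->
  (unit_norm q f x < +oo)%E.
Proof.
move=> [_ fq] x0; apply: le_lt_trans fq; apply: ereal_sup_ubound.
by exists x => //=; rewrite in_itv/= andbT.
Qed.

Lemma uniformly_locally1_left_integrable f : uniformly_locally_Lq 1 f ->
  left_integrable (f \_ `[0, +oo[).
Proof.
move=> uf; have [mf _] := uf; apply: left_integrable_unit_integral => // n.
by rewrite -unit_norm1E; exact: uniformly_locally_lty.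
Qed.

Lemma uniformly_locally2_left_integrable f : uniformly_locally_Lq 2 f ->
  left_integrable (f \_ `[0, +oo[).
Proof.
move=> uf; have [mf _] := uf; apply: left_integrable_unit_integral => // n.
apply: le_lt_trans (unit_integral_le_norm2 _ mf) _ => //.
exact: uniformly_locally_lty.
Qed.

Lemma integrable_halfline f : mu.-integrable `[0, +oo[ (EFin \o f) ->
  mu.-integrable setT (EFin \o f \_ `[0, +oo[).
Proof. by move=> /integrable_mkcond; rewrite restrict_EFin; apply. Qed.

(** A unit integral is the increment over [x, x + 1] of a primitive of |f|, and that primitive
    converges at +oo. *)
Lemma cvg_unit_integral f : mu.-integrable `[0, +oo[ (EFin \o f) ->
  unit_integral f x @[x --> +oo] --> 0%E.
Proof.
move=> fi.
pose g := (Num.norm \o f) \_ `[0, +oo[.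
have ig : mu.-integrable setT (EFin \o g).
  exact: integrable_halfline (integrable_norm fi).
have cg := cvg_primitive ig.
have cg1 : primitive g (x + 1) @[x --> +oo] --> \int[mu]_t g t.
  apply: (@cvg_comp _ _ _ (fun x => x + 1) (primitive g) +oo +oo) => //.
  apply/cvgryPge => A; near=> x; rewrite -lerBlDr.
  by near: x; apply: nbhs_pinfty_ge; exact: num_real.
apply: (@cvg_trans _ ((primitive g (x + 1) - primitive g x)%:E @[x --> +oo])).
  apply: near_eq_cvg; near=> x.
  have x0 : 0 <= x by near: x; apply: nbhs_pinfty_ge; exact: num_real.
  have ilg := integrable_left_integrable ig.
  rewrite primitiveB ?lerDl// /Rintegral fineK; last first.
    by apply: integrable_fin_num => //; exact: left_integrable_itv.
  rewrite -integral_itv_bndo_bndc; last first.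
    apply: measurable_funS (measurable_int _ (left_integrable_itv x (x + 1) ilg)) => //.
    by apply: subset_itvl; rewrite bnd_simp.
  apply: eq_integral => t; rewrite inE/= in_itv/= => /andP[xt _].
  by rewrite /g patchE mem_set//= in_itv/= andbT (le_trans x0)// ltW.
rewrite (_ : 0%E = (\int[mu]_t g t - \int[mu]_t g t)%:E); last by rewrite subrr.
apply: cvg_EFin; first exact: nearW.
exact: cvgB.
Unshelve. all: by end_near. Qed.

End UnitNorms.

(** * Comparison of two decompositions *)

Section TwoDecompositions.
Context {R : realType}.
Local Notation mu := (@lebesgue_measure R).

Lemma test_function_bounded (phi : R -> R) : test_function phi ->
  exists a K : R, [/\ forall t, `|phi t| <= K, forall t, `|derive1 phi t| <= K,
    forall t, a < t -> phi t = 0, forall t, a < t -> derive1 phi t = 0 &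
    measurable_fun setT phi /\ measurable_fun setT (derive1 phi)].
Proof.
move=> [dphi [a [b [a0 phi0]]]].
have phi0' t : t < a \/ b < t -> phi t = 0.
  move=> tab; apply: phi0; rewrite notin_setE/= in_itv/= => /andP[at_ tb].
  by case: tab; rewrite ltNge ?at_ ?tb.
have c0 : continuous phi.
  move=> x; apply: differentiable_continuous; apply/derivable1_diffP; exact: (dphi 0%N).
have c1 : continuous (derive1 phi).
  move=> x; apply: differentiable_continuous; apply/derivable1_diffP; exact: (dphi 1%N).
have d0 t : t < a \/ b < t -> derive1 phi t = 0.
  move=> tab; rewrite derive1E (@near_eq_derive _ _ _ _ (cst 0)) ?derive_cst//.
  case: tab => tab; near=> s; apply: phi0'.
    by left; near: s; exact: lt_nbhsl.
  by right; near: s; exact: lt_nbhsr.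
have bnd (f : R -> R) : continuous f -> (forall t, t < a \/ b < t -> f t = 0) ->
    exists2 K : R, 0 <= K & forall t, `|f t| <= K.
  (* [test_function] allows b < a; such a function vanishes everywhere. *)
  move=> cf f0; have [ab|ba] := leP a b; last first.
    exists 0 => // t; rewrite f0 ?normr0//.
    by have [ta|ta] := ltP t a; [left|right; exact: lt_le_trans ba ta].
  have [|c _ fc] := @EVT_max _ (fun t => `|f t|) a b ab.
    by apply: continuous_subspaceT => t; apply: cvg_norm; exact: cf.
  exists `|f c| => // t; have [ta|ta] := ltP t a; first by rewrite f0 ?normr0//; left.
  have [tb|tb] := leP t b; last by rewrite f0 ?normr0//; right.
  by apply: fc; rewrite in_itv/= ta.
have [K K0 phiK] := bnd _ c0 phi0'; have [K' K'0 dphiK] := bnd _ c1 d0.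
exists b, (K + K'); split.
- by move=> t; rewrite (le_trans (phiK t))// lerDl.
- by move=> t; rewrite (le_trans (dphiK t))// lerDr.
- by move=> t bt; apply: phi0'; right.
- by move=> t bt; apply: d0; right.
- by split; apply: continuous_measurable_fun.
Unshelve. all: by end_near. Qed.

Lemma unit_integral_restrict (f : R -> R) x : 0 <= x ->
  unit_integral (f \_ `[0, +oo[) x = unit_integral f x.
Proof.
move=> x0; apply: eq_integral => t; rewrite inE/= in_itv/= => /andP[xt _].
by rewrite patchE mem_set//= in_itv/= andbT (le_trans x0)// ltW.
Qed.

Lemma restrict_halfline_mulE (f psi : R -> R) :
  \int[mu]_(t in `[0, +oo[) (f t * psi t) = \int[mu]_t ((f \_ `[0, +oo[) t * psi t).
Proof.
rewrite Rintegral_mkcond; apply: eq_Rintegral => t _.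
by rewrite !patchE; case: ifPn => //; rewrite mul0r.
Qed.

(** Equating the two formulas for V phi says that sigma - sigma0 has weak derivative tau0 - tau on
    ]0, +oo[. *)
Lemma decompositions_primitive (V : half_line_distribution R)
    (sigma tau sigma0 tau0 : R -> R) :
  left_integrable (sigma \_ `[0, +oo[) -> left_integrable (tau \_ `[0, +oo[) ->
  left_integrable (sigma0 \_ `[0, +oo[) -> left_integrable (tau0 \_ `[0, +oo[) ->
  decomposes V sigma tau -> decomposes V sigma0 tau0 ->
  exists c : R, {ae mu, forall x, 0 < x -> sigma x - sigma0 x =
    c + primitive (tau0 \_ `[0, +oo[ \- tau \_ `[0, +oo[) x}.
Proof.
move=> is_ it is0 it0 Vst Vst0.
have [||phi tphi|c wE] := @du_Bois_Reymond R
    (sigma \_ `[0, +oo[ \- sigma0 \_ `[0, +oo[) (tau0 \_ `[0, +oo[ \- tau \_ `[0, +oo[).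
- by move=> y; exact: (integrableB _ (is_ y) (is0 y)).
- by move=> y; exact: (integrableB _ (it0 y) (it y)).
- have [a [K [phiK dphiK phi0 dphi0 [mphi mdphi]]]] := test_function_bounded tphi.
  have I f : left_integrable f -> mu.-integrable setT (EFin \o (fun t => f t * phi t)).
    by move=> fi; exact: integrable_mul_left_bounded phi0.
  have I' f : left_integrable f ->
      mu.-integrable setT (EFin \o (fun t => f t * derive1 phi t)).
    by move=> fi; exact: integrable_mul_left_bounded dphi0.
  have := Vst0 _ tphi; rewrite (Vst _ tphi).
  rewrite /distributional_derivative /regular_functional !restrict_halfline_mulE.
  have E psi (f g : R -> R) : mu.-integrable setT (EFin \o (fun t => f t * psi t)) ->
      mu.-integrable setT (EFin \o (fun t => g t * psi t)) ->
      \int[mu]_t ((f \- g) t * psi t) =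
      \int[mu]_t (f t * psi t) - \int[mu]_t (g t * psi t).
    move=> fi gi; rewrite -RintegralB//.
    by apply: eq_Rintegral => t _; rewrite /= mulrBl.
  rewrite !E; [|exact: I|exact: I|exact: I'|exact: I'].
  by lra.
exists c; move: wE; apply: filterS; first exact: (ae_filter_ringOfSetsType mu).
move=> x wx x0; rewrite -wx//= !patchE mem_set//= in_itv/= andbT; exact: ltW.
Qed.

Lemma unit_integralB_le (f g : R -> R) (x : R) : 0 <= x ->
  measurable_fun (`[0, +oo[ : set R) f -> measurable_fun (`[0, +oo[ : set R) g ->
  (unit_integral (f \- g)%R x <= unit_integral f x + unit_integral g x)%E.
Proof.
move=> x0 mf mg.
have sub : `]x, x + 1[ `<=` (`[0, +oo[ : set R).
  move=> t; rewrite /= !in_itv/= andbT => /andP[xt _].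
  by rewrite (le_trans x0)// ltW.
have nf (k : R -> R) : measurable_fun (`[0, +oo[ : set R) k ->
    measurable_fun `]x, x + 1[ (fun t => `|k t|%:E).
  move=> mk; apply/measurable_EFinP; apply: measurableT_comp => //.
  exact: measurable_funS mk.
rewrite /unit_integral -ge0_integralD//; [|exact: nf|exact: nf].
apply: ge0_le_integral => //.
- by apply: nf; exact: measurable_funB.
- by apply: emeasurable_funD; exact: nf.
- by move=> t _; rewrite -EFinD lee_fin ler_normB.
Qed.

(** Write W for c + primitive h. On ]x, x + 1[ it oscillates by at most the integral of |h|, so |W
    x| <= |W t| + that integral; averaging over t in this interval of measure 1 turns norm decay
    into pointwise decay. *)
Lemma primitive_le_unit_integral (w h : R -> R) (c x : R) : 0 <= x ->
  left_integrable h -> measurable_fun (`[0, +oo[ : set R) w ->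
  {ae mu, forall t, 0 < t -> w t = c + primitive h t} ->
  (`|c + primitive h x|%:E <= unit_integral w x + unit_integral h x)%E.
Proof.
move=> x0 ih mw wE.
pose W t := c + primitive h t; rewrite -/(W x).
have mW : measurable_fun setT W.
  apply: measurable_funD => //; apply: continuous_measurable_fun.
  exact: continuous_primitive.
have muI : mu `]x, x + 1[ = 1%E.
  rewrite [LHS](lebesgue_measure_itv `]x, x + 1[%R)/= lte_fin ltrDl ltr01.
  by rewrite -EFinB addrAC subrr add0r.
have mh : measurable_fun setT h by have [] := left_integrable_locally ih.
have -> : unit_integral w x = unit_integral W x.
  apply: ae_eq_integral => //.
  - apply/measurable_EFinP; apply: measurableT_comp => //.
    apply: measurable_funS mw => // t; rewrite /= !in_itv/= andbT => /andP[xt _].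
    by rewrite (le_trans x0)// ltW.
  - apply/measurable_EFinP; apply: measurableT_comp => //.
    exact: measurable_funS mW.
  move: wE; apply: filterS; first exact: (ae_filter_ringOfSetsType mu).
  move=> t wt; rewrite /= in_itv/= => /andP[xt _]; rewrite wt//.
  exact: le_lt_trans xt.
have dW t : x < t -> t < x + 1 -> (`|W t - W x|%:E <= unit_integral h x)%E.
  move=> xt tx1; rewrite /W opprD addrACA subrr add0r primitiveB ?(ltW xt)//.
  have iht := left_integrable_itv x t ih.
  rewrite EFin_normr_Rintegral//; apply: le_trans (le_abse_integral _ _ _) _ => //.
    exact: measurable_int _ iht.
  apply: ge0_subset_integral => //=.
  - apply/measurable_EFinP; apply: measurableT_comp => //.
    exact: measurable_funS mh.
  - move=> s; rewrite /= !in_itv/= => /andP[-> st]; exact: le_lt_trans tx1.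
have mnW : measurable_fun `]x, x + 1[ (fun t => `|W t|%:E).
  apply/measurable_EFinP; apply: measurableT_comp => //; exact: measurable_funS mW.
apply: (@le_trans _ _ (\int[mu]_(t in `]x, (x + 1)%R[)
    (`|W t|%:E + unit_integral h x))%E).
  rewrite -[leLHS]mule1 -[in leLHS]muI -integral_cst//.
  apply: ge0_le_integral => //=.
  - exact: emeasurable_funD.
  - move=> t; rewrite in_itv/= => /andP[xt tx]; apply: (@le_trans _ _
      (`|W t| + `|W t - W x|)%:E).
      by rewrite lee_fin -lerBlDl -[`|W t - W x|]distrC (le_trans (lerB_dist _ _))// distrC.
    by rewrite EFinD leeD2l// dW.
rewrite ge0_integralD//; last by move=> *; exact: unit_integral_ge0.
have -> : (\int[mu]_(t in `]x, (x + 1)%R[) unit_integral h x = unit_integral h x)%E.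
  rewrite (integral_cst mu _ (unit_integral h x))//.
  transitivity (unit_integral h x * 1)%E; last by rewrite mule1.
  by congr (_ * _)%E; exact: muI.
exact: lexx.
Qed.

(** W x is controlled by the unit integrals of sigma, tau, sigma0 and tau0 at x: those of the first
    two decay by hypothesis, those of the last two by integrability. *)
Lemma decompositions_decay (V : half_line_distribution R)
    (sigma tau sigma0 tau0 : R -> R) :
  lpLq 1 2 sigma0 -> lpLq 1 1 tau0 -> decomposes V sigma0 tau0 ->
  decaying_decomposition V sigma tau ->
  exists c : R, let W x := c + primitive (tau0 \_ `[0, +oo[ \- tau \_ `[0, +oo[) x in
    {ae mu, forall x, 0 < x -> sigma x = sigma0 x + W x} /\
    W x @[x --> +oo] --> 0.
Proof.
move=> ls0 lt0 Vst0 [us ut Vst dec].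
have [ms0 _] := ls0; have [mt0 _] := lt0; have [ms _] := us; have [mt _] := ut.
have is_ := uniformly_locally2_left_integrable us.
have it := uniformly_locally1_left_integrable ut.
have restr f : mu.-integrable `[0, +oo[ (EFin \o f) -> left_integrable (f \_ `[0, +oo[).
  by move=> fi; exact: integrable_left_integrable (integrable_halfline fi).
have is0 := restr _ (lpLq2_integrable ls0).
have it0 := restr _ (lpLq1_integrable lt0).
have [c wE] := decompositions_primitive is_ it is0 it0 Vst Vst0.
exists c => W; split.
  move: wE; apply: filterS; first exact: (ae_filter_ringOfSetsType mu).
  by move=> x wx x0; rewrite /W -wx// addrC subrK.
have ih : left_integrable (tau0 \_ `[0, +oo[ \- tau \_ `[0, +oo[).
  by move=> y; exact: (integrableB _ (it0 y) (it y)).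
pose b x := (unit_norm 2 sigma x + unit_norm 1 tau x +
  (unit_integral sigma0 x + unit_integral tau0 x))%E.
have b0 : b x @[x --> +oo] --> 0%E.
  rewrite -[X in _ --> X](adde0 0%E); apply: cvgeD => //.
  rewrite -[X in _ --> X](adde0 0%E); apply: cvgeD => //.
    exact: cvg_unit_integral (lpLq2_integrable ls0).
  exact: cvg_unit_integral (lpLq1_integrable lt0).
have Wb : \forall x \near +oo, (`|W x|%:E <= b x)%E.
  near=> x.
  have x0 : 0 <= x by near: x; apply: nbhs_pinfty_ge; exact: num_real.
  have mw : measurable_fun (`[0, +oo[ : set R) (sigma \- sigma0) by exact: measurable_funB.
  apply: le_trans (primitive_le_unit_integral x0 ih mw wE) _.
  apply: (@le_trans _ _ (unit_integral sigma x + unit_integral sigma0 x +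
    (unit_integral tau0 x + unit_integral tau x))%E).
    apply: leeD; first exact: unit_integralB_le.
    rewrite -(unit_integral_restrict tau0 x0) -(unit_integral_restrict tau x0).
    apply: unit_integralB_le => //.
      by have [m _ _] := left_integrable_locally it0; exact: measurable_funS m.
    by have [m _ _] := left_integrable_locally it; exact: measurable_funS m.
  rewrite [X in (_ + X <= _)%E]addeC addeACA /b unit_norm1E.
  by rewrite leeD2r// leeD2r// unit_integral_le_norm2.
move/fine_cvgP : b0 => [bfin /cvgrPdist_le b0].
apply/cvgrPdist_le => e e0; near=> x; rewrite sub0r normrN -lee_fin.
have bx : b x \is a fin_num by near: x.
apply: (@le_trans _ _ (b x)); first by near: x.
rewrite -(fineK bx) lee_fin (le_trans (ler_norm _))//.
by rewrite -normrN -sub0r; near: x; exact: b0.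
Unshelve. all: by end_near. Qed.

End TwoDecompositions.

(** * Variation of constants *)

Section Trigo.
Context {R : realType}.

Lemma cos_lipschitz (x y : R) : x <= y -> `|cos y - cos x| <= y - x.
Proof.
move=> xy; have [|c _ ->] := @MVT_segment _ cos (fun z => - sin z) x y xy.
  by apply: continuous_subspaceT; exact: continuous_cos.
rewrite normrM normrN (ger0_norm (_ : 0 <= y - x)) ?subr_ge0//.
by rewrite ler_piMl ?subr_ge0// ler_norml sin_geN1 sin_le1.
Qed.

Lemma sin_lipschitz (x y : R) : x <= y -> `|sin y - sin x| <= y - x.
Proof.
move=> xy; have [|c _ ->] := @MVT_segment _ sin cos x y xy.
  by apply: continuous_subspaceT; exact: continuous_sin.
rewrite normrM (ger0_norm (_ : 0 <= y - x)) ?subr_ge0//.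
by rewrite ler_piMl ?subr_ge0// ler_norml cos_geN1 cos_le1.
Qed.

Lemma cos_sin_bounds (x : R) : `|cos x| <= 1 /\ `|sin x| <= 1.
Proof. by rewrite !ler_norml cos_geN1 cos_le1 sin_geN1 sin_le1. Qed.

End Trigo.

Lemma integrable_mul_bounded (R : realType) (f b : R -> R) (K : R) :
  (@lebesgue_measure R).-integrable setT (EFin \o f) -> measurable_fun setT b ->
  (forall x, `|b x| <= K) ->
  (@lebesgue_measure R).-integrable setT (EFin \o (fun x => f x * b x)).
Proof.
move=> fi mb bK; have K0 : 0 <= K by apply: le_trans (bK 0).
apply: (le_integrable measurableT _ _ (integrableZr measurableT K fi)).
  apply/measurable_EFinP; apply: measurable_funM => //.
  by have /measurable_int/measurable_EFinP := fi.
by move=> x _ /=; rewrite lee_fin !normrM ler_wpM2l// (ger0_norm K0).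
Qed.

Section RealSolution.
Context {R : realType}.
Local Notation mu := (@lebesgue_measure R).
Variables (s t : R -> R) (k c0 c1 : R).
Hypothesis is_ : mu.-integrable setT (EFin \o s).
Hypothesis is2 : mu.-integrable setT (EFin \o (fun x => s x ^+ 2)).
Hypothesis it : mu.-integrable setT (EFin \o t).
Hypothesis k0 : 0 < k.

Let C x := cos (k * x).
Let S x := sin (k * x).

Let is_derive_C (x : R) : is_derive x 1 C (- (k * S x)).
Proof.
rewrite -mulNr mulrC /S mulrN -mulNr.
apply: (@is_derive1_comp _ cos (fun x => k * x)).
by apply: is_derive_eq; rewrite /GRing.scale/= mulr1.
Qed.

Let is_derive_S (x : R) : is_derive x 1 S (k * C x).
Proof.
rewrite mulrC.
apply: (@is_derive1_comp _ sin (fun x => k * x)).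
by apply: is_derive_eq; rewrite /GRing.scale/= mulr1.
Qed.

Let mC : measurable_fun setT C.
Proof.
apply: continuous_measurable_fun => x; apply: differentiable_continuous.
by apply/derivable1_diffP; have ? := is_derive_C x; exact: ex_derive.
Qed.

Let mS : measurable_fun setT S.
Proof.
apply: continuous_measurable_fun => x; apply: differentiable_continuous.
by apply/derivable1_diffP; have ? := is_derive_S x; exact: ex_derive.
Qed.

(* With y = p C + q S and y1 = k (q C - p S) the equations y' = s y + y1 and
   y1' = - s y1 + (t - s^2 - k^2) y become z' = A z for z = (p, q), where p is
   indexed by true and q by false. *)
Let a1 (i j : bool) x : R :=
  if i then (if j then C x * C x - S x * S x else 2 * (S x * C x))
  else (if j then 2 * (S x * C x) else S x * S x - C x * C x).

Let a2 (i j : bool) x : R :=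
  (if i then (if j then - (S x * C x) else - (S x * S x))
   else (if j then C x * C x else S x * C x)) / k.

Let A (i j : bool) x : R := s x * a1 i j x + (t x - s x ^+ 2) * a2 i j x.

Let iA i j : mu.-integrable setT (EFin \o A i j).
Proof.
have [mCC mSS mSC] : [/\ measurable_fun setT (fun x => C x * C x),
    measurable_fun setT (fun x => S x * S x) &
    measurable_fun setT (fun x => S x * C x)] by split; exact: measurable_funM.
have bd x : [/\ `|C x * C x| <= 1, `|S x * S x| <= 1 & `|S x * C x| <= 1].
  have [c s1] := cos_sin_bounds (k * x).
  by split; rewrite normrM mulr_ile1.
have ma1 : measurable_fun setT (a1 i j).
  case: i; case: j; rewrite /a1; first exact: measurable_funB; last exact: measurable_funB.
    by apply: measurable_funM.
  by apply: measurable_funM.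
have ma2 : measurable_fun setT (a2 i j).
  apply: measurable_funM => //.
  by case: i ma1; case: j => _ //; apply: measurable_funN.
have ba1 x : `|a1 i j x| <= 2.
  have [c1' s1' sc1] := bd x; rewrite /a1; case: i ma1 ma2; case: j => _ _;
    by rewrite ?normrM ?(ger0_norm (ler0n _ 2)) -?normrM ?(le_trans (ler_normB _ _))//; lra.
have ba2 x : `|a2 i j x| <= k^-1.
  have [c1' s1' sc1] := bd x; rewrite /a2 normrM normfV (gtr0_norm k0).
  rewrite ler_piMl ?invr_ge0 ?(ltW k0)//.
  by case: i ma1 ma2 ba1; case: j => _ _ _; rewrite ?normrN.
have i1 := integrable_mul_bounded is_ ma1 ba1.
have i2 := integrable_mul_bounded (integrableB measurableT it is2) ma2 ba2.
exact: (integrableD measurableT i1 i2).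
Qed.

Lemma real_solution : exists y y1 : R -> R,
  [/\ forall r, absolutely_continuous_on 0 r (fun x => (y x)%:C) /\
        absolutely_continuous_on 0 r (fun x => (y1 x)%:C),
      {ae mu, forall x : R, is_derive x 1 y (s x * y x + y1 x) /\
        is_derive x 1 y1 (- s x * y1 x + (t x - s x ^+ 2 - k ^+ 2) * y x)},
      exists B : R, forall x, `|y x| <= B,
      y x - (c0 * cos (k * x) + c1 * sin (k * x)) @[x --> +oo] --> 0 &
      y1 x - k * (c1 * cos (k * x) - c0 * sin (k * x)) @[x --> +oo] --> 0].
Proof.
have [Z [iG [B ZB] ZE]] := Volterra_solution (fun b : bool => if b then c0 else c1) iA.
pose G i x := \sum_j A i j x * Z j x.
have GE i x : G i x = A i true x * Z true x + A i false x * Z false x.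
  by rewrite /G big_bool.
have Zfun i : Z i = fun x => (if i then c0 else c1) - \int[mu]_t G i t +
    primitive (G i) x.
  by apply/funext => x; exact: ZE.
have Zlim i : Z i x @[x --> +oo] --> (if i then c0 else c1).
  rewrite Zfun -[X in _ --> X](subrK (\int[mu]_t G i t)).
  by apply: cvgD; [exact: cvg_cst|exact: cvg_primitive (iG i)].
have acZ i r : absolutely_continuous_on 0 r (fun x => (Z i x)%:C).
  rewrite (_ : (fun x => _) = (fun x => ((if i then c0 else c1) -
    \int[mu]_t G i t)%:C + (primitive (G i) x)%:C)).
    apply: absolutely_continuous_onD; first exact: absolutely_continuous_on_cst.
    apply: absolutely_continuous_on_primitive.
    exact: integrable_left_integrable (iG i).
  by apply/funext => x; rewrite -rmorphD {1}Zfun.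
have dZ : {ae mu, forall x : R, is_derive x 1 (Z true) (G true x) /\
    is_derive x 1 (Z false) (G false x)}.
  have := ae_is_derive_primitive (integrable_left_integrable (iG false)).
  have := ae_is_derive_primitive (integrable_left_integrable (iG true)).
  apply: filterS2; first exact: (ae_filter_ringOfSetsType mu).
  have D i (x : R) : is_derive x 1 (primitive (G i)) (G i x) ->
      is_derive x 1 (Z i) (G i x).
    move=> dp; rewrite Zfun -[G i x]add0r.
    exact: (is_deriveD (is_derive_cst _ _ _) dp).
  by move=> x dt df; split; [exact: (D true x dt)|exact: (D false x df)].
exists (fun x => Z true x * C x + Z false x * S x),
  (fun x => k * (Z false x * C x - Z true x * S x)).
have acC r : absolutely_continuous_on 0 r (fun x => (C x)%:C).
  apply: (@absolutely_continuous_on_lipschitz _ _ _ _ k) => x y xy.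
  rewrite -rmorphB normc_real mulrBr; apply: cos_lipschitz.
  by rewrite ler_wpM2l// ltW.
have acS r : absolutely_continuous_on 0 r (fun x => (S x)%:C).
  apply: (@absolutely_continuous_on_lipschitz _ _ _ _ k) => x y xy.
  rewrite -rmorphB normc_real mulrBr; apply: sin_lipschitz.
  by rewrite ler_wpM2l// ltW.
have acM (f g : R -> R) (M N : R) r : (forall x, `|f x| <= M) -> (forall x, `|g x| <= N) ->
    absolutely_continuous_on 0 r (fun x => (f x)%:C) ->
    absolutely_continuous_on 0 r (fun x => (g x)%:C) ->
    absolutely_continuous_on 0 r (fun x => (f x * g x)%:C).
  move=> fM gN af ag.
  rewrite (_ : (fun x => _) = (fun x => (f x)%:C * (g x)%:C)); last first.
    by apply/funext => x; rewrite rmorphM.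
  apply: (absolutely_continuous_onM (M := M) (N := N) af ag) => x _.
    by rewrite normc_real.
  by rewrite normc_real.
have acD (f g : R -> R) r : absolutely_continuous_on 0 r (fun x => (f x)%:C) ->
    absolutely_continuous_on 0 r (fun x => (g x)%:C) ->
    absolutely_continuous_on 0 r (fun x => (f x + g x)%:C).
  move=> af ag; rewrite (_ : (fun x => _) = (fun x => (f x)%:C + (g x)%:C)).
    exact: absolutely_continuous_onD.
  by apply/funext => x; rewrite rmorphD.
have C1 x : `|C x| <= 1 by have [] := cos_sin_bounds (k * x).
have S1 x : `|S x| <= 1 by have [] := cos_sin_bounds (k * x).
have cvgM0 (f b : R -> R) : f x @[x --> +oo] --> 0 -> (forall x, `|b x| <= 1) ->
    f x * b x @[x --> +oo] --> 0.
  move=> f0 b1; apply/cvgr0Pnorm_le => e e0.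
  move/cvgr0Pnorm_le : f0 => /(_ _ e0); apply: filterS => x fe.
  by rewrite normrM (le_trans _ fe)// ler_piMr.
have Z0 i : Z i x - (if i then c0 else c1) @[x --> +oo] --> 0.
  by apply/subr_cvg0; exact: Zlim.
split.
- move=> r; split.
    by apply: acD; [exact: acM (ZB _) C1 _ _|exact: acM (ZB _) S1 _ _].
  have ZC x : `|Z false x * C x| <= B.
    by rewrite normrM (le_trans _ (ZB false x))// ler_piMr.
  have ZS x : `|Z true x * S x| <= B.
    by rewrite normrM (le_trans _ (ZB true x))// ler_piMr.
  have cst1 (c : R) : absolutely_continuous_on 0 r (fun=> c%:C).
    exact: absolutely_continuous_on_cst.
  apply: (acM (fun=> k) (fun x => Z false x * C x - Z true x * S x) k (B + B)).
  - by move=> _; rewrite gtr0_norm.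
  - by move=> x; rewrite (le_trans (ler_normB _ _))// lerD.
  - exact: cst1.
  apply: (acD (fun x => Z false x * C x) (fun x => - (Z true x * S x))).
    exact: acM (ZB _) C1 _ _.
  rewrite (_ : (fun x => _) = (fun x => (-1 * (Z true x * S x))%:C)); last first.
    by apply/funext => x; rewrite mulN1r.
  apply: (acM (fun=> -1) (fun x => Z true x * S x) 1 B) => //.
  - by move=> _; rewrite normrN1.
  - exact: acM (ZB _) S1 _ _.
- move: dZ; apply: filterS; first exact: (ae_filter_ringOfSetsType mu).
  move=> x [dt df]; have dC := is_derive_C x; have dS := is_derive_S x.
  have CS1 : C x ^+ 2 + S x ^+ 2 = 1 by exact: cos2Dsin2.
  have k_neq0 : k != 0 by rewrite gt_eqF.
  (* The left-hand side is cubic in C and S, the right-hand side linear. Multiplying the latter by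
     C^2 + S^2 = 1 makes both homogeneous of degree 3 and leaves a formal identity. The term - k^2 y
     is absent from [eG2], since it comes from differentiating C and S. *)
  have eG1 : G true x * C x + G false x * S x =
      s x * (Z true x * C x + Z false x * S x).
    rewrite -[RHS]mulr1 -CS1 !GE /A /a1 /a2; field.
    exact: k_neq0.
  have eG2 : k * (G false x * C x - G true x * S x) =
      - s x * (k * (Z false x * C x - Z true x * S x)) +
      (t x - s x ^+ 2) * (Z true x * C x + Z false x * S x).
    rewrite -[RHS]mulr1 -CS1 !GE /A /a1 /a2; field.
    exact: k_neq0.
  split; apply: is_derive_eq; rewrite /GRing.scale/=.
    rewrite -eG1; ring.
  rewrite mulrBl addrA -eG2; ring.
- exists (B + B) => x.
  rewrite (le_trans (ler_normD _ _))// !normrM lerD//.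
    by rewrite (le_trans _ (ZB true x))// ler_piMr.
  by rewrite (le_trans _ (ZB false x))// ler_piMr.
- rewrite (_ : (fun x => _) = (fun x => (Z true x - c0) * C x + (Z false x - c1) * S x)).
    rewrite -[X in _ --> X]addr0; apply: cvgD.
      exact: (cvgM0 _ _ (Z0 true) C1).
    exact: (cvgM0 _ _ (Z0 false) S1).
  by apply/funext => x; rewrite -/(C x) -/(S x); ring.
rewrite (_ : (fun x => _) =
    (fun x => k * ((Z false x - c1) * C x + - ((Z true x - c0) * S x)))).
  rewrite -[X in _ --> X](mulr0 k); apply: cvgMr.
  rewrite -[X in _ --> X]addr0; apply: cvgD.
    exact: (cvgM0 _ _ (Z0 false) C1).
  rewrite -oppr0; apply: cvgN; exact: (cvgM0 _ _ (Z0 true) S1).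
by apply/funext => x; rewrite -/(C x) -/(S x); ring.
Qed.

End RealSolution.

(** * The complex eigensolution *)

Section Complex.
Context {R : realType}.
Implicit Types (f g : R -> R) (a b x y : R).

Lemma complexD_i x y : x +i* y = x%:C + 'i * y%:C.
Proof. by apply/eqP; rewrite eq_complex/=; apply/andP; split; apply/eqP; ring. Qed.

Lemma mul_real_complex a x y : a%:C * (x +i* y) = (a * x) +i* (a * y).
Proof. by apply/eqP; rewrite eq_complex/=; apply/andP; split; apply/eqP; ring. Qed.

Lemma normc_le x y : normc (x +i* y) <= `|x| + `|y|.
Proof.
rewrite complexD_i (le_trans (le_normcD _ _))//.
by rewrite ComplexField.Normc.normcM normc_i mul1r !normc_real.
Qed.

Lemma absolutely_continuous_on_complex a b f g :
  absolutely_continuous_on a b (fun x => (f x)%:C) ->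
  absolutely_continuous_on a b (fun x => (g x)%:C) ->
  absolutely_continuous_on a b (fun x => f x +i* g x).
Proof.
move=> af ag.
rewrite (_ : (fun x => _) = (fun x => (f x)%:C + 'i * (g x)%:C)); last first.
  by apply/funext => x; rewrite complexD_i.
apply: absolutely_continuous_onD => // e e0.
have [d d0 dP] := ag _ e0; exists d => // n s t st tr sd.
apply: le_lt_trans (dP n s t st tr sd); apply: ler_sum => j _.
by rewrite -mulrBr ComplexField.Normc.normcM normc_i mul1r.
Qed.

Lemma cvg_normc0 f g : f x @[x --> +oo] --> 0 -> g x @[x --> +oo] --> 0 ->
  normc (f x +i* g x) @[x --> +oo] --> 0.
Proof.
move=> f0 g0; apply: (@squeeze_cvgr _ _ _ _ (cst 0) (fun x => `|f x| + `|g x|)).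
- by apply: nearW => x; rewrite normc_ge0 normc_le.
- exact: cvg_cst.
- rewrite -[X in _ --> X]addr0 -{1 2}(@normr0 _ R).
  by apply: cvgD; apply: cvg_norm.
Qed.

End Complex.

Section HalfLine.
Context {R : realType}.
Local Notation mu := (@lebesgue_measure R).

Lemma continuous_bounded_itv (f : R -> R) (r : R) : continuous f ->
  exists M : R, forall x, 0 <= x <= r -> `|f x| <= M.
Proof.
move=> cf; have [r0|r0] := leP 0 r; last first.
  by exists 0 => x /andP[x0 xr]; have := le_lt_trans (le_trans x0 xr) r0; rewrite ltxx.
have [|c _ fc] := @EVT_max _ (fun t => `|f t|) 0 r r0.
  by apply: continuous_subspaceT => t; apply: cvg_norm; exact: cf.
by exists `|f c| => x x0r; apply: fc; rewrite in_itv.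
Qed.

(** Links [primitive] to the integral from 0 in [wkb_phase]. *)
Lemma primitive_halfline (f : R -> R) (x : R) :
  primitive (f \_ `[0, +oo[) x = \int[mu]_(t in `[0, x]) f t.
Proof.
rewrite /primitive -Rintegral_mkcondr; congr Rintegral.
apply/seteqP; split => t /=; rewrite !in_itv/= !andbT.
  by move=> [-> ->].
by move=> /andP[-> ->].
Qed.

Lemma restrict_halfline (f : R -> R) (x : R) : 0 < x -> (f \_ `[0, +oo[) x = f x.
Proof. by move=> x0; rewrite patchE mem_set//= in_itv/= andbT ltW. Qed.

End HalfLine.

(** * Transfer to the given decaying decomposition *)

Unset Implicit Arguments.
Set Strict Implicit.

Theorem theorem1p2 (R : realType) (V : half_line_distribution R)
    (hV : lpHm1 1 V)
    (sigma tau : R -> R) (hdec : decaying_decomposition V sigma tau)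
    (E : R) (hE : 0 < E) :
  exists u u1 : R -> R[i],
    eigensolution sigma tau E u u1 /\ WKB tau (Num.sqrt E) u u1.
Proof.
have [sigma0 [tau0 [ls0 [lt0 Vst0]]]] := hV.
have [c] := decompositions_decay ls0 lt0 Vst0 hdec.
set T0 := tau0 \_ _; set Tr := tau \_ _; set h := T0 \- Tr.
pose W x := c + primitive h x; rewrite -/W => -[sigmaE W0].
pose S0 := sigma0 \_ `[0, +oo[.
set k := Num.sqrt E.
have k0 : 0 < k by rewrite sqrtr_gt0.
have kE : k ^+ 2 = E by rewrite sqr_sqrtr// ltW.
have iS := integrable_halfline (lpLq2_integrable ls0).
have iS2 : lebesgue_measure.-integrable setT (EFin \o (fun x => S0 x ^+ 2)).
  have := integrable_halfline (lpLq2_integrable_sqr ls0).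
  rewrite (_ : (fun t => sigma0 t ^+ 2) \_ _ = (fun x => S0 x ^+ 2))//.
  by apply/funext => x; rewrite /S0 !patchE; case: ifPn => // _; rewrite expr0n.
have iT : lebesgue_measure.-integrable setT (EFin \o T0).
  exact: integrable_halfline (lpLq1_integrable lt0).
have iTr : left_integrable Tr.
  by have [_ ut _ _] := hdec; exact: uniformly_locally1_left_integrable.
have ih : left_integrable h.
  by move=> y; exact: (integrableB _ (integrable_left_integrable iT y) (iTr y)).
have cW : continuous W.
  by move=> x; apply: cvgD; [exact: cvg_cst|exact: continuous_primitive].
have dW : {ae lebesgue_measure, forall x : R, is_derive x 1 W (h x)}.
  have := ae_is_derive_primitive ih.
  apply: filterS; first exact: (ae_filter_ringOfSetsType (@lebesgue_measure R)).
  move=> x dp; rewrite -[h x]add0r.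
  exact: (is_deriveD (is_derive_cst _ _ _) dp).
have acW r : absolutely_continuous_on 0 r (fun x => (W x)%:C).
  rewrite (_ : (fun x => _) = (fun x => c%:C + (primitive h x)%:C)).
    apply: absolutely_continuous_onD; first exact: absolutely_continuous_on_cst.
    exact: absolutely_continuous_on_primitive.
  by apply/funext => x; rewrite -rmorphD.
(* The limit of wkb_phase tau k x - k x: the primitive of [tau] is that of [tau0] minus W - c, and W
   -> 0. *)
pose theta := - (2 * k)^-1 * (\int[lebesgue_measure]_t T0 t + c).
have phaseE x : wkb_phase tau k x = k * x - (2 * k)^-1 * (primitive T0 x - (W x - c)).
  have hE' : primitive h x = primitive T0 x - primitive Tr x.
    by rewrite /primitive -RintegralB//; exact: integrable_left_integrable iT x.
  by rewrite /wkb_phase -primitive_halfline -/Tr /W hE'; ring.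
have phase_lim : k * x + theta - wkb_phase tau k x @[x --> +oo] --> 0.
  rewrite (_ : (fun x => _) = (fun x => (2 * k)^-1 *
      ((primitive T0 x - \int[lebesgue_measure]_t T0 t) - W x))); last first.
    by apply/funext => x; rewrite phaseE /theta; ring.
  rewrite -[X in _ --> X](mulr0 (2 * k)^-1); apply: cvgMr.
  rewrite -[X in _ --> X](subr0 0); apply: cvgB => //.
  by apply/subr_cvg0; exact: cvg_primitive.
have lip_lim (f : R -> R) : (forall x y, x <= y -> `|f y - f x| <= y - x) ->
    f (k * x + theta) - f (wkb_phase tau k x) @[x --> +oo] --> 0.
  move=> lf; apply/cvgr0Pnorm_le => e e0.
  move/cvgr0Pnorm_le : phase_lim => /(_ _ e0); apply: filterS => x; apply: le_trans.
  set a := k * x + theta; set b := wkb_phase tau k x.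
  have [ab|/ltW ba] := leP a b; last by rewrite (ger0_norm (_ : 0 <= a - b)) ?subr_ge0 ?lf.
  by rewrite distrC [leRHS]distrC (ger0_norm (_ : 0 <= b - a)) ?subr_ge0 ?lf.
have cos_lim := lip_lim _ cos_lipschitz.
have sin_lim := lip_lim _ sin_lipschitz.
(* The data are the coefficients of cos (k x) and sin (k x) in cos (k x + theta) for the real part
   and in sin (k x + theta) for the imaginary part. *)
have [ya [ya1 [acya dya [Ba yaB] ya_lim ya1_lim]]] :=
  real_solution (cos theta) (- sin theta) iS iS2 iT k0.
have [yb [yb1 [acyb dyb [Bb ybB] yb_lim yb1_lim]]] :=
  real_solution (sin theta) (cos theta) iS iS2 iT k0.
exists (fun x => ya x +i* yb x),
  (fun x => (ya1 x - W x * ya x) +i* (yb1 x - W x * yb x)).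
(* The correction W y of the quasiderivative is o(1) because y is bounded, so it does not disturb
   the asymptotics. *)
have W_lim (y : R -> R) (B : R) : (forall x, `|y x| <= B) ->
    W x * y x @[x --> +oo] --> 0.
  move=> yB; have B0 : 0 <= B by apply: le_trans (yB 0).
  apply/cvgr0Pnorm_le => e e0.
  have e1 : 0 < e / (B + 1) by rewrite divr_gt0// ltr_wpDl.
  move/cvgr0Pnorm_le : W0 => /(_ _ e1); apply: filterS => x We.
  rewrite normrM (le_trans (ler_pM _ _ We (yB x)))// mulrAC -mulrA.
  by rewrite ler_piMr ?(ltW e0)// ler_pdivrMr ?mul1r ?lerDl// ltr_wpDl.
have acu1 (y y1 : R -> R) (B : R) (r : R) : (forall x, `|y x| <= B) ->
    absolutely_continuous_on 0 r (fun x => (y x)%:C) ->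
    absolutely_continuous_on 0 r (fun x => (y1 x)%:C) ->
    absolutely_continuous_on 0 r (fun x => (y1 x - W x * y x)%:C).
  move=> yB ay ay1; have [M WM] := continuous_bounded_itv r cW.
  rewrite (_ : (fun x => _) = (fun x => (y1 x)%:C + (- 1)%:C * ((W x)%:C * (y x)%:C))).
    apply: absolutely_continuous_onD => //.
    have aWy : absolutely_continuous_on 0 r (fun x => (W x)%:C * (y x)%:C).
      apply: (absolutely_continuous_onM (M := M) (N := B)) => // x x0r.
        by rewrite normc_real WM.
      by rewrite normc_real yB.
    apply: (absolutely_continuous_onM (M := 1) (N := `|M| * B)) => //.
    - exact: absolutely_continuous_on_cst.
    - by move=> x _; rewrite normc_real normrN1.
    - move=> x x0r; rewrite -rmorphM normc_real normrM ler_pM//.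
      exact: le_trans (WM x x0r) (ler_norm _).
  by apply/funext => x; rewrite -!rmorphM -rmorphD mulN1r.
have dom (y y1 : R -> R) (x : R) : 0 < x -> sigma x = sigma0 x + W x ->
    is_derive x 1 y (S0 x * y x + y1 x) ->
    y1 x - W x * y x = derive1 y x - sigma x * y x.
  move=> x0 -> dy; rewrite derive1E derive_val /S0 restrict_halfline//; ring.
(* Differentiating W y produces (tau0 - tau) y, which trades [tau0] for [tau]; the other terms in W
   cancel against the expansion of (sigma0 + W)^2. *)
have eq_ell (y y1 : R -> R) (x : R) : 0 < x -> sigma x = sigma0 x + W x ->
    is_derive x 1 W (h x) -> is_derive x 1 y (S0 x * y x + y1 x) ->
    is_derive x 1 y1 (- S0 x * y1 x + (T0 x - S0 x ^+ 2 - k ^+ 2) * y x) ->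
    - derive1 (fun x => y1 x - W x * y x) x - sigma x * (y1 x - W x * y x)
      + (tau x - sigma x ^+ 2) * y x = E * y x.
  move=> x0 -> dWx dy dy1.
  have -> : derive1 (fun x => y1 x - W x * y x) x =
      - S0 x * y1 x + (T0 x - S0 x ^+ 2 - k ^+ 2) * y x -
      (W x * (S0 x * y x + y1 x) + y x * h x).
    rewrite derive1E; apply: derive_val.
  rewrite /h /T0 /Tr /S0 /= !restrict_halfline// kE; ring.
split; [split|split].
- split.
  + move=> r r0; have [? _] := acya r; have [? _] := acyb r.
    exact: absolutely_continuous_on_complex.
  + move=> r r0; have [ay ay1] := acya r; have [by_ by1] := acyb r.
    by apply: absolutely_continuous_on_complex; [exact: acu1 yaB _ _|exact: acu1 ybB _ _].
  + move: dya dyb sigmaE.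
    apply: filterS3; first exact: (ae_filter_ringOfSetsType (@lebesgue_measure R)).
    move=> x [da _] [db _] sx x0; rewrite /cderive1 mul_real_complex.
    apply/eqP; rewrite eq_complex/= -(dom _ _ _ x0 (sx x0) da) -(dom _ _ _ x0 (sx x0) db).
    by rewrite !eqxx.
- have dWs : {ae lebesgue_measure, forall x : R, is_derive x 1 W (h x) /\
      (0 < x -> sigma x = sigma0 x + W x)}.
    move: dW sigmaE; apply: filterS2; last by move=> x.
    exact: (ae_filter_ringOfSetsType (@lebesgue_measure R)).
  move: dya dyb dWs.
  apply: filterS3; first exact: (ae_filter_ringOfSetsType (@lebesgue_measure R)).
  move=> x [da da1] [db db1] [dWx sx] x0.
  rewrite /ell /cderive1 !mul_real_complex; apply/eqP; rewrite eq_complex/=.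
  rewrite -(eq_ell _ _ _ x0 (sx x0) dWx da da1) -(eq_ell _ _ _ x0 (sx x0) dWx db db1).
  by rewrite !eqxx.
- have ra : ya x - cos (wkb_phase tau k x) @[x --> +oo] --> 0.
    rewrite -[X in _ --> X]addr0.
    rewrite (_ : (fun x => _) = (fun x =>
      (ya x - (cos theta * cos (k * x) + - sin theta * sin (k * x))) +
      (cos (k * x + theta) - cos (wkb_phase tau k x)))); first exact: cvgD.
    by apply/funext => x; rewrite (cosD (k * x) theta); ring.
  have rb : yb x - sin (wkb_phase tau k x) @[x --> +oo] --> 0.
    rewrite -[X in _ --> X]addr0.
    rewrite (_ : (fun x => _) = (fun x =>
      (yb x - (sin theta * cos (k * x) + cos theta * sin (k * x))) +
      (sin (k * x + theta) - sin (wkb_phase tau k x)))); first exact: cvgD.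
    by apply/funext => x; rewrite (sinD (k * x) theta); ring.
  exact: (cvg_normc0 ra rb).
(* The target i k e^(i phase) has real part - k sin (phase) and imaginary part k cos (phase). *)
have ra : ya1 x - W x * ya x + k * sin (wkb_phase tau k x) @[x --> +oo] --> 0.
  rewrite (_ : (fun x => _) = (fun x =>
    (ya1 x - k * (- sin theta * cos (k * x) - cos theta * sin (k * x))) - W x * ya x -
    k * (sin (k * x + theta) - sin (wkb_phase tau k x)))); last first.
    by apply/funext => x; rewrite (sinD (k * x) theta); ring.
  rewrite (_ : 0 = 0 - 0 - k * 0); last by rewrite mulr0 !subr0.
  by apply: cvgB; [apply: cvgB => //; exact: W_lim yaB|exact: cvgMr].
have rb : yb1 x - W x * yb x - k * cos (wkb_phase tau k x) @[x --> +oo] --> 0.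
  rewrite (_ : (fun x => _) = (fun x =>
    (yb1 x - k * (cos theta * cos (k * x) - sin theta * sin (k * x))) - W x * yb x +
    k * (cos (k * x + theta) - cos (wkb_phase tau k x)))); last first.
    by apply/funext => x; rewrite (cosD (k * x) theta); ring.
  rewrite (_ : 0 = 0 - 0 + k * 0); last by rewrite mulr0 subr0 addr0.
  by apply: cvgD; [apply: cvgB => //; exact: W_lim ybB|exact: cvgMr].
rewrite (_ : (fun x => _) = (fun x => normc
    ((ya1 x - W x * ya x + k * sin (wkb_phase tau k x)) +i*
     (yb1 x - W x * yb x - k * cos (wkb_phase tau k x))))); first exact: (cvg_normc0 ra rb).
apply/funext => x; congr normc; rewrite /expi; apply/eqP; rewrite eq_complex/=.
by apply/andP; split; apply/eqP; ring.
Qed.
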